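(* Let $n$ and $d$ be integers with $n\geq 2d\geq 2$. Then the circulant graph $G=C_n(1,2,\ldots,d)$ is $S_2$ if and only if either $n\leq 3d+2$ and $n\neq 2d+2$, or $n=4d+3$.
   Context: For an integer $n\geq 1$ and $S\subseteq\{1,2,\ldots,\lfloor n/2\rfloor\}$, the circulant graph $C_n(S)$ has vertex set $\{0,1,\ldots,n-1\}$ and edge set $\{\{i,j\} : |i-j|\in S \text{ or } n-|i-j|\in S\}$. One writes $C_n(a_1,\ldots,a_t)$ for $C_n(\{a_1,\ldots,a_t\})$. The independence complex $\mathrm{Ind}(G)$ of a finite simple graph $G$ is the simplicial complex whose faces are the independent sets of $G$ (including the empty set). A simplicial complex $\Delta$ satisfies Serre's condition $S_2$ (over a field $k$) if its Stanley-Reisner ring $R=k[\Delta]$ satisfies $\mathrm{depth}(R_p)\geq\min\{2,\dim R_p\}$ for all primes $p$. It is known that this holds if and only if $\mathrm{link}_\Delta(F)$ is connected for every face $F\in\Delta$ (including $F=\emptyset$) with $\dim\mathrm{link}_\Delta(F)\geq 1$, where $\mathrm{link}_\Delta(F)=\{H\in\Delta : H\cap F=\emptyset,\ H\cup F\in\Delta\}$; in particular it does not depend on $k$. A graph $G$ is called $S_2$ if $\mathrm{Ind}(G)$ satisfies $S_2$. *)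

(* Defs.v *)
From HB Require Import structures.
From mathcomp Require Import all_boot all_order all_algebra.
From mathcomp Require Import generic_quotient ring_quotient.
From mathcomp Require Import mpoly boolp ring.

Set Implicit Arguments.
Unset Strict Implicit.
Unset Printing Implicit Defensive.

Import GRing.Theory.
Local Open Scope ring_scope.
Local Open Scope quotient_scope.

(* Localization of a commutative ring at a prime ideal: fractions a/s with
   s \notin p, where a/s = b/t iff u(at - bs) = 0 for some u \notin p. *)
Section Localization.
Variables (R : comNzRingType) (p : prime_idealr R).

Definition denom := {s : R | s \notin (p : pred R)}.
Definition lfrac := (R * denom)%type.
HB.instance Definition _ := Choice.on lfrac.

Implicit Types (x y z : lfrac) (s t : denom).

Lemma denom1_subproof : 1 \notin (p : pred R).
Proof. by rewrite idealr1. Qed.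

Lemma denomM_subproof s t : sval s * sval t \notin (p : pred R).
Proof. by rewrite prime_idealrM negb_or (valP s) (valP t). Qed.

Definition denom1 : denom := exist _ 1 denom1_subproof.
Definition denomM s t : denom := exist _ (sval s * sval t) (denomM_subproof s t).

Definition loc_equiv x y : bool :=
  `[< exists u : denom, sval u * (x.1 * sval y.2 - y.1 * sval x.2) = 0 >].

Lemma loc_equivP x y :
  reflect (exists u : denom, sval u * (x.1 * sval y.2) = sval u * (y.1 * sval x.2))
          (loc_equiv x y).
Proof.
apply: (iffP idP) => [/asboolP[u hu]|[u hu]]; last first.
  by apply/asboolP; exists u; rewrite mulrBr hu subrr.
by exists u; apply/eqP; rewrite -subr_eq0 -mulrBr hu.
Qed.

Lemma loc_equiv_refl : reflexive loc_equiv.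
Proof. by move=> x; apply/loc_equivP; exists denom1. Qed.

Lemma loc_equiv_sym : ssrbool.symmetric loc_equiv.
Proof.
by move=> x y; apply/loc_equivP/loc_equivP => -[u hu]; exists u; rewrite hu.
Qed.

Lemma loc_equiv_trans : transitive loc_equiv.
Proof.
move=> y x z /loc_equivP[u hu] /loc_equivP[v hv]; apply/loc_equivP.
exists (denomM (denomM u v) y.2) => /=.
transitivity (sval v * sval z.2 * (sval u * (x.1 * sval y.2))); first by ring.
rewrite hu.
transitivity (sval u * sval x.2 * (sval v * (y.1 * sval z.2))); first by ring.
by rewrite hv; ring.
Qed.

Canonical loc_equiv_equiv :=
  EquivRel loc_equiv loc_equiv_refl loc_equiv_sym loc_equiv_trans.

Definition loc := {eq_quot loc_equiv}.
HB.instance Definition _ : EqQuotient _ loc_equiv loc := EqQuotient.on loc.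
HB.instance Definition _ := Choice.on loc.

Lemma loc_eqP x y :
  reflect (exists u : denom, sval u * (x.1 * sval y.2) = sval u * (y.1 * sval x.2))
          (x == y %[mod loc]).
Proof. by rewrite eqmodE; apply: loc_equivP. Qed.

Lemma loc_reprP x :
  exists u : denom, sval u * ((repr (\pi_loc x)).1 * sval x.2)
                  = sval u * (x.1 * sval (repr (\pi_loc x)).2).
Proof. by apply/loc_eqP; rewrite reprK. Qed.

Lemma lfrac_eq x y :
  x.1 * sval y.2 = y.1 * sval x.2 -> x = y %[mod loc].
Proof. by move=> h; apply/eqP/loc_eqP; exists denom1; rewrite h. Qed.

Definition lfrac_add x y : lfrac :=
  (x.1 * sval y.2 + y.1 * sval x.2, denomM x.2 y.2).
Definition lfrac_opp x : lfrac := (- x.1, x.2).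
Definition lfrac_mul x y : lfrac := (x.1 * y.1, denomM x.2 y.2).

Definition loc_embed := lift_embed loc (fun a : R => (a, denom1) : lfrac).
Canonical loc_embed_pi_morph := PiEmbed loc_embed.

Definition loc_add := lift_op2 loc lfrac_add.
Definition loc_opp := lift_op1 loc lfrac_opp.
Definition loc_mul := lift_op2 loc lfrac_mul.

Lemma pi_loc_add : {morph \pi_loc : x y / lfrac_add x y >-> loc_add x y}.
Proof.
move=> x y; unlock loc_add; apply/eqP/loc_eqP => /=.
have [u hu] := loc_reprP x; have [v hv] := loc_reprP y.
set x' := repr _ in hu *; set y' := repr _ in hv *.
exists (denomM u v) => /=.
transitivity (sval v * sval y.2 * sval y'.2 * (sval u * (x.1 * sval x'.2))
            + sval u * sval x.2 * sval x'.2 * (sval v * (y.1 * sval y'.2))).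
  by ring.
by rewrite -hu -hv; ring.
Qed.
Canonical pi_loc_add_morph := PiMorph2 pi_loc_add.

Lemma pi_loc_opp : {morph \pi_loc : x / lfrac_opp x >-> loc_opp x}.
Proof.
move=> x; unlock loc_opp; apply/eqP/loc_eqP => /=.
have [u hu] := loc_reprP x.
by exists u; rewrite !mulNr !mulrN hu.
Qed.
Canonical pi_loc_opp_morph := PiMorph1 pi_loc_opp.

Lemma pi_loc_mul : {morph \pi_loc : x y / lfrac_mul x y >-> loc_mul x y}.
Proof.
move=> x y; unlock loc_mul; apply/eqP/loc_eqP => /=.
have [u hu] := loc_reprP x; have [v hv] := loc_reprP y.
set x' := repr _ in hu *; set y' := repr _ in hv *.
exists (denomM u v) => /=.
transitivity (sval u * (x.1 * sval x'.2) * (sval v * (y.1 * sval y'.2))).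
  by ring.
by rewrite -hu -hv; ring.
Qed.
Canonical pi_loc_mul_morph := PiMorph2 pi_loc_mul.

Lemma loc_addA : associative loc_add.
Proof.
elim/quotW=> x; elim/quotW=> y; elim/quotW=> z; rewrite !piE.
by apply: lfrac_eq => /=; ring.
Qed.

Lemma loc_addC : commutative loc_add.
Proof.
elim/quotW=> x; elim/quotW=> y; rewrite !piE.
by apply: lfrac_eq => /=; ring.
Qed.

Lemma loc_add0 : left_id (loc_embed 0) loc_add.
Proof. by elim/quotW=> x; rewrite !piE; apply: lfrac_eq => /=; ring. Qed.

Lemma loc_addN : left_inverse (loc_embed 0) loc_opp loc_add.
Proof. by elim/quotW=> x; rewrite !piE; apply: lfrac_eq => /=; ring. Qed.

HB.instance Definition _ :=
  GRing.isZmodule.Build loc loc_addA loc_addC loc_add0 loc_addN.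

Lemma loc_mulA : associative loc_mul.
Proof.
elim/quotW=> x; elim/quotW=> y; elim/quotW=> z; rewrite !piE.
by apply: lfrac_eq => /=; ring.
Qed.

Lemma loc_mulC : commutative loc_mul.
Proof.
elim/quotW=> x; elim/quotW=> y; rewrite !piE.
by apply: lfrac_eq => /=; ring.
Qed.

Lemma loc_mul1 : left_id (loc_embed 1) loc_mul.
Proof. by elim/quotW=> x; rewrite !piE; apply: lfrac_eq => /=; ring. Qed.

Lemma loc_mulDl : left_distributive loc_mul loc_add.
Proof.
elim/quotW=> x; elim/quotW=> y; elim/quotW=> z; rewrite !piE.
by apply: lfrac_eq => /=; ring.
Qed.

Lemma loc_1neq0 : loc_embed 1 != loc_embed 0.
Proof.
rewrite piE; apply/negP => /loc_equivP[u] /= /eqP.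
by rewrite !mulr1 mulr0 => /eqP hu; have := valP u; rewrite /= hu idealr0.
Qed.

HB.instance Definition _ := GRing.Zmodule_isComNzRing.Build loc
  loc_mulA loc_mulC loc_mul1 loc_mulDl loc_1neq0.

End Localization.

Section CommutativeAlgebra.
Variable A : comNzRingType.

Definition krull_dim_geq (r : nat) : Prop :=
  exists P : nat -> prime_idealr A, forall i, (i < r)%N ->
    {subset P i <= P i.+1} /\ exists2 a, a \in P i.+1 & a \notin P i.

Definition gen_ideal (s : seq A) (a : A) : Prop :=
  exists c : 'I_(size s) -> A, a = \sum_i c i * s`_i.

Definition regular_sequence (s : seq A) : Prop :=
  ~ gen_ideal s 1 /\
  forall i, (i < size s)%N -> forall a,
    gen_ideal (take i s) (s`_i * a) -> gen_ideal (take i s) a.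

(* Meant for a local ring A, whose maximal ideal is the set of nonunits: the
   depth is the supremum of the lengths of regular sequences in that ideal. *)
Definition depth_geq (r : nat) : Prop :=
  exists s : seq A, [/\ size s = r,
    forall a, a \in s -> ~ exists b, a * b = 1 & regular_sequence s].

End CommutativeAlgebra.

(* depth R_p >= min (l, dim R_p) for every prime p, with the inequality between
   the two sides expressed through their natural number lower bounds, so that
   infinite dimension needs no special value. *)
Definition serre_condition (l : nat) (R : comNzRingType) : Prop :=
  forall (p : prime_idealr R) (r : nat), (r <= l)%N ->
    krull_dim_geq (loc p) r -> depth_geq (loc p) r.

Record simplicial_complex (T : finType) := SimplicialComplex {
  faces :> {set {set T}};
  faces_set0 : set0 \in faces;
  faces_sub : forall F H : {set T}, H \subset F -> F \in faces -> H \in faces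
}.

Section StanleyReisner.
Variables (k : fieldType) (n : nat) (D : simplicial_complex 'I_n).

(* The ideal generated by the squarefree monomials of the nonfaces of D. *)
Definition SR_ideal (f : {mpoly k[n]}) : bool :=
  `[< exists c : {set 'I_n} -> {mpoly k[n]},
        f = \sum_(F : {set 'I_n} | F \notin (D : {set {set 'I_n}}))
              c F * \prod_(i in F) 'X_i >].

Lemma SR_ideal_closed : idealr_closed SR_ideal.
Proof.
split.
- by apply/asboolP; exists (fun=> 0); rewrite big1 // => F _; rewrite mul0r.
- apply/asboolP => -[c /(congr1 (mmap idfun (fun=> 0)))] /eqP.
  rewrite rmorph1 rmorph_sum big1 ?oner_eq0 // => F FD.
  have [F0|[i iF]] := set_0Vmem F; first by rewrite F0 faces_set0 in FD.
  by rewrite rmorphM (bigD1 i) //= rmorphM /= mmapX mmap1U mul0r mulr0.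
- move=> a f g /asboolP[c ->] /asboolP[e ->]; apply/asboolP.
  exists (fun F => a * c F + e F).
  rewrite big_distrr -big_split; apply: eq_bigr => F _ /=.
  by rewrite mulrDl mulrA.
Qed.

HB.instance Definition _ :=
  isIdealr.Build {mpoly k[n]} SR_ideal SR_ideal_closed.

Definition SR_ring : comNzRingType := {ideal_quot (SR_ideal : idealr {mpoly k[n]})}.

End StanleyReisner.

Section Independence.
Variables (T : finType) (e : rel T).

Definition independent (A : {set T}) : bool :=
  [forall x in A, forall y in A, ~~ e x y].

Lemma independent_set0 : set0 \in [set A | independent A].
Proof. by rewrite inE; apply/forall_inP => x; rewrite inE. Qed.

Lemma independent_sub (A B : {set T}) : B \subset A ->
  A \in [set A | independent A] -> B \in [set A | independent A].
Proof.
move=> /subsetP sBA; rewrite !inE => /forall_inP indA.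
apply/forall_inP => x /sBA /indA /forall_inP indx.
by apply/forall_inP => y /sBA /indx.
Qed.

Definition independence_complex : simplicial_complex T :=
  SimplicialComplex independent_set0 independent_sub.

End Independence.

Definition is_S2 (k : fieldType) (n : nat) (e : rel 'I_n) : Prop :=
  serre_condition 2 (SR_ring k (independence_complex e)).

(* Only meant for S included in {1, ..., n./2}. *)
Definition circulant (n : nat) (S : {pred nat}) : rel 'I_n :=
  fun i j => let m := `|i%:Z - j%:Z|%N in (m \in S) || ((n - m)%N \in S).

Arguments circulant n S : clear implicits.

Lemma circulant_sym n S : ssrbool.symmetric (circulant n S).
Proof. by move=> i j; rewrite /circulant distnC. Qed.

Lemma circulant_irr n (S : {pred nat}) :
  (forall s, s \in S -> (1 <= s <= n./2)%N) -> irreflexive (circulant n S).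
Proof.
move=> hS i; rewrite /circulant subrr absz0 subn0.
apply/negbTE; rewrite negb_or; apply/andP; split; apply/negP => /hS //.
case/andP => n1; rewrite leqNgt => /negP[].
by rewrite -divn2 ltn_Pdiv.
Qed.

(* Main.v *)
Require Import Defs.
From HB Require Import structures.
From mathcomp Require Import all_boot all_order all_algebra.
From mathcomp Require Import generic_quotient ring_quotient.
From mathcomp Require Import mpoly boolp ring zify.

(**
Both conditions are compared with a property of the links of [D]: whenever the
link of a face [F] has an edge, its 1-skeleton is connected.

Let [p] be a prime of [k[D]] and [F] the face of the variables outside [p].  The
localization at [p] embeds in the product, over the faces [G] containing [F], of
localized polynomial rings in the variables of [G], and a compatible family on
these faces glues to an element.  This reduces depth at least 2 to finding [a]
and [b] in [p] that form a regular sequence on every large [G] and such that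
quotients by [a] agree on overlaps.
- If [p] meets [k[X_i, i in F]] in 0, take the sums of the [X_i] and of the
  [X_i ^+ i.+1] over the [i] outside [F]; connectedness of the link is what makes
  the quotients agree on [F].
- If [p] meets [k[X_i, i in F]] in [a <> 0] and [F] is not a facet, take [a] and the
  sum of the [X_i] outside [F].
- If [F] is a facet, choose [T] maximal in [F] with [p] meeting [k[X_i, i in T]] in
  0.  Dimension at least 2 gives two variables of [F] outside [T], each algebraic
  modulo [p] over [T]; their equations form a regular sequence.

Conversely, if the link of [F] has an edge but splits into two parts, let [p] be
generated by the [X_i] outside [F], and write [a = a1 + a2], [b = b1 + b2] for the
decomposition along the two parts.  Then [b * a1 = b1 * a], and [a1] being a
multiple of [a] would force a denominator into [p].

For circulant graphs, a link is disconnected with an edge exactly when the cyclic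
gaps left by [F] have a single one with room for further vertices, the number of
these being between [d + 2] and [2 * d + 1].
*)

Set Implicit Arguments.
Unset Strict Implicit.
Unset Printing Implicit Defensive.

Import GRing.Theory.
Local Open Scope ring_scope.
Local Open Scope quotient_scope.

(** Primes are bare predicates, so that pulling one back along a ring morphism is plain composition
    [q \o g]. *)
Record is_prime (B : comNzRingType) (q : B -> Prop) : Prop := IsPrime {
  prime0 : q 0;
  primeD : forall f g, q f -> q g -> q (f + g);
  primeMl : forall a f, q f -> q (a * f);
  prime1 : ~ q 1;
  prime_or : forall f g, q (f * g) -> q f \/ q g }.

Section Primes.
Variable B : comNzRingType.

Lemma primeN (q : B -> Prop) f : is_prime q -> q f -> q (- f).
Proof. by move=> pq qf; rewrite -mulN1r; apply: primeMl. Qed.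

Lemma primeB (q : B -> Prop) f g : is_prime q -> q f -> q g -> q (f - g).
Proof. by move=> pq qf qg; apply: primeD => //; apply: primeN. Qed.

Lemma primeMr (q : B -> Prop) f a : is_prime q -> q f -> q (f * a).
Proof. by move=> pq qf; rewrite mulrC; apply: primeMl. Qed.

Lemma prime_sum (q : B -> Prop) (I : Type) (r : seq I) (P : pred I) (E : I -> B) :
  is_prime q -> (forall i, P i -> q (E i)) -> q (\sum_(i <- r | P i) E i).
Proof.
by move=> pq qE; apply: (big_ind q) => //; [exact: (prime0 pq)|exact: (primeD pq)].
Qed.

Lemma prime_prod (q : B -> Prop) (I : finType) (P : pred I) (E : I -> B) :
  is_prime q -> q (\prod_(i | P i) E i) -> exists2 i, P i & q (E i).
Proof.
move=> pq; apply: contraPP => nE.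
apply: (big_ind (fun x => ~ q x)) => [|f g nf ng /(prime_or pq)[]//|i Pi qi].
  exact: prime1.
by apply: nE; exists i.
Qed.

Lemma primeX (q : B -> Prop) f m : is_prime q -> q (f ^+ m) -> q f.
Proof.
move=> pq; elim: m => [|m IHm]; first by rewrite expr0 => /(prime1 pq).
by rewrite exprS => /(prime_or pq)[].
Qed.

Lemma is_prime_idealr (p : prime_idealr B) : is_prime (fun x => x \in p).
Proof.
split; first exact: idealr0.
- by move=> f g pf pg; apply: rpredD.
- by move=> a f; apply: idealMr.
- by rewrite idealr1.
- by move=> f g; rewrite prime_idealrM => /orP.
Qed.

Lemma is_prime_preim (C : comNzRingType) (g : {rmorphism B -> C}) (q : C -> Prop) :
  is_prime q -> is_prime (q \o g).
Proof.
move=> pq; split => /=.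
- by rewrite rmorph0; apply: prime0.
- by move=> x y qx qy; rewrite rmorphD; apply: primeD.
- by move=> a x qx; rewrite rmorphM; apply: primeMl.
- by rewrite rmorph1; apply: prime1.
- by move=> x y; rewrite rmorphM; apply: prime_or.
Qed.

End Primes.

(** * Localization at a prime and depth *)

Lemma gen_ideal0 (A : comNzRingType) (a : A) : gen_ideal [::] a <-> a = 0.
Proof.
split=> [[c ->]|->]; first by rewrite big_ord0.
by exists (fun=> 0); rewrite big_ord0.
Qed.

Lemma gen_ideal1 (A : comNzRingType) (a b : A) :
  gen_ideal [:: a] b <-> exists c, b = c * a.
Proof.
split=> [[c ->]|[c ->]]; first by exists (c ord0); rewrite big_ord1.
by exists (fun=> c); rewrite big_ord1.
Qed.

Lemma gen_ideal2 (A : comNzRingType) (a b c : A) :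
  gen_ideal [:: a; b] c -> exists x y, c = x * a + y * b.
Proof.
case=> z ->; exists (z ord0), (z (lift ord0 ord0)).
by rewrite big_ord_recl big_ord1.
Qed.

Section LocalizationTheory.
Variables (R : comNzRingType) (p : prime_idealr R).

Definition loc_of (a : R) : loc p := \pi_(loc p) (a, denom1 p).

Lemma loc_pi_add x y : \pi_(loc p) x + \pi_(loc p) y = \pi_(loc p) (lfrac_add x y).
Proof. by rewrite pi_loc_add. Qed.
Lemma loc_pi_opp x : - \pi_(loc p) x = \pi_(loc p) (lfrac_opp x).
Proof. by rewrite pi_loc_opp. Qed.
Lemma loc_pi_mul x y : \pi_(loc p) x * \pi_(loc p) y = \pi_(loc p) (lfrac_mul x y).
Proof. by rewrite pi_loc_mul. Qed.
Lemma loc_pi1 : 1 = loc_of 1.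
Proof. by rewrite -[1]/(loc_embed p 1) piE. Qed.
Lemma loc_pi0 : 0 = loc_of 0.
Proof. by rewrite -[0]/(loc_embed p 0) piE. Qed.

Lemma loc_of_zmod : zmod_morphism loc_of.
Proof.
move=> x y; rewrite /loc_of loc_pi_opp loc_pi_add.
by apply: lfrac_eq => /=; ring.
Qed.

Lemma loc_of_monoid : monoid_morphism loc_of.
Proof.
split; first by rewrite loc_pi1.
by move=> x y; rewrite /loc_of loc_pi_mul; apply: lfrac_eq => /=; ring.
Qed.

HB.instance Definition _ := GRing.isZmodMorphism.Build R (loc p) loc_of loc_of_zmod.
HB.instance Definition _ :=
  GRing.isMonoidMorphism.Build R (loc p) loc_of loc_of_monoid.

Lemma loc_of_eq0 a : loc_of a = 0 <-> exists2 u, u \notin p & u * a = 0.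
Proof.
rewrite loc_pi0; split=> [/eqP/loc_eqP[u /=]|[u up ua0]].
  by rewrite mul0r mulr0 mulr1 => ua0; exists (sval u) => //; apply: (valP u).
by apply/eqP/loc_eqP; exists (exist _ u up) => /=; rewrite mul0r mulr0 mulr1.
Qed.

Lemma loc_fracP (z : loc p) :
  exists a s, s \notin p /\ z * loc_of s = loc_of a.
Proof.
elim/quotW: z => -[a s]; exists a, (sval s); split; first exact: (valP s).
by rewrite /loc_of loc_pi_mul; apply: lfrac_eq => /=; ring.
Qed.

Lemma loc_of_unit s : s \notin p -> exists t, loc_of s * t = 1.
Proof.
move=> sp; exists (\pi_(loc p) (1, exist _ s sp)).
by rewrite loc_pi1 /loc_of loc_pi_mul; apply: lfrac_eq => /=; ring.
Qed.

Lemma loc_of_nonunit s t : s \in p -> loc_of s * t <> 1.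
Proof.
move=> sp; elim/quotW: t => -[a w]; rewrite loc_pi1 /loc_of loc_pi_mul.
move=> /eqP/loc_eqP[u /=]; rewrite mulr1 !mul1r => e.
have : sval u * sval w \notin p.
  by rewrite prime_idealrM negb_or (valP u) (valP w).
by rewrite -e idealMr // mulrC idealMr.
Qed.

Lemma loc_of_mulI s x : s \notin p -> x * loc_of s = 0 -> x = 0.
Proof.
move=> /loc_of_unit[t st1] xs0.
by rewrite -[x]mulr1 -st1 mulrA xs0 mul0r.
Qed.

(** Contraction along [loc_of] stays strict because every fraction is a unit times the image of its
    numerator. *)
Lemma loc_chain r : krull_dim_geq (loc p) r -> exists Q : nat -> R -> Prop,
  [/\ forall i, is_prime (Q i), forall i x, Q i x -> x \in p &
   forall i, (i < r)%N ->
     (forall x, Q i x -> Q i.+1 x) /\ exists2 x, Q i.+1 x & ~ Q i x].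
Proof.
case=> P hP; pose Q i x := loc_of x \in P i; exists Q.
have pQ i : is_prime (Q i).
  exact: (is_prime_preim loc_of (is_prime_idealr (P i))).
split=> // [i x Qx|i ir].
  apply: contraPT Qx => /loc_of_unit[t st1] Qx.
  by apply: (prime1 (is_prime_idealr (P i))); rewrite -st1 mulrC idealMr.
have [sP [z zP zNP]] := hP i ir; split=> [x|]; first exact: sP.
have [a [s [sp e]]] := loc_fracP z.
exists a; first by rewrite /Q -e mulrC idealMr.
move=> Qa; apply/negP: zNP; have [t st1] := loc_of_unit sp.
rewrite -[z]mulr1 -st1 mulrA e mulrC negbK; exact: idealMr.
Qed.

Lemma depth_geq0 : depth_geq (loc p) 0.
Proof.
exists [::]; split=> //; split=> // -[c /=].
by rewrite big_ord0 => /eqP; rewrite oner_eq0.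
Qed.

Lemma depth_geq1 a : a \in p ->
  (forall x, loc_of a * loc_of x = 0 -> loc_of x = 0) -> depth_geq (loc p) 1.
Proof.
move=> ap aI; exists [:: loc_of a]; split=> //.
  by move=> b; rewrite inE => /eqP -> [t]; apply: loc_of_nonunit.
split; first by move/gen_ideal1 => [c /esym]; rewrite mulrC; apply: loc_of_nonunit.
case=> // _ z; rewrite /= !gen_ideal0 => az0.
have [x [s [sp e]]] := loc_fracP z.
by apply: (loc_of_mulI sp); rewrite e; apply: aI; rewrite -e mulrA az0 mul0r.
Qed.

Lemma depth_geq2 a b : a \in p -> b \in p ->
  (forall x, loc_of a * loc_of x = 0 -> loc_of x = 0) ->
  (forall x y, loc_of b * loc_of x = loc_of a * loc_of y ->
    exists z, loc_of x = z * loc_of a) ->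
  depth_geq (loc p) 2.
Proof.
move=> ap bp aI bI; exists [:: loc_of a; loc_of b]; split=> //.
  by move=> c; rewrite !inE => /orP[] /eqP -> [t]; apply: loc_of_nonunit.
split.
  move/gen_ideal2 => [x [y]].
  have [x' [s [sp ex]]] := loc_fracP x; have [y' [t [tp ey]]] := loc_fracP y.
  move=> /(congr1 (fun z => z * loc_of (s * t))).
  rewrite mul1r mulrDl rmorphM.
  rewrite (_ : _ + _ = (x * loc_of s) * loc_of a * loc_of t
     + (y * loc_of t) * loc_of b * loc_of s); last by ring.
  rewrite ex ey -!rmorphM -rmorphD /= => e.
  have [u] : exists t', loc_of (s * t) * t' = 1.
    by apply: loc_of_unit; rewrite prime_idealrM negb_or sp.
  rewrite e; apply: loc_of_nonunit.
  by rewrite rpredD // mulrC idealMr // idealMr.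
case=> [|[|//]] _ z /=.
  rewrite !gen_ideal0 => az0.
  have [x [s [sp e]]] := loc_fracP z.
  by apply: (loc_of_mulI sp); rewrite e; apply: aI; rewrite -e mulrA az0 mul0r.
rewrite !gen_ideal1 => -[c ebz].
have [x [s [sp e]]] := loc_fracP z; have [y [t [tp ec]]] := loc_fracP c.
have [w ew] : exists w, loc_of (x * t) = w * loc_of a.
  apply: (bI _ (y * s)); rewrite !rmorphM /= -e -ec.
  transitivity (loc_of b * z * loc_of s * loc_of t); first by ring.
  by rewrite ebz; ring.
have [s' ss'] := loc_of_unit sp; have [t' tt'] := loc_of_unit tp.
exists (w * s' * t'); transitivity (w * loc_of a * s' * t'); last by ring.
rewrite -ew rmorphM /= -e.
transitivity (z * (loc_of s * s') * (loc_of t * t')); last by ring.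
by rewrite ss' tt' !mulr1.
Qed.

(** Numerators replace the two members of the sequence; they lie in [p] because the fractions are
    nonunits. *)
Lemma depth_geq2_elim : depth_geq (loc p) 2 -> exists a b,
  [/\ a \in p, b \in p, forall x, loc_of a * loc_of x = 0 -> loc_of x = 0 &
  forall x y, loc_of b * loc_of x = loc_of a * loc_of y ->
    exists z s, s \notin p /\ loc_of (s * x) = loc_of (z * a)].
Proof.
case=> s0 []; case: s0 => [|a [|b [|]]] // _ nu [_ reg].
have [a' [s [sp ea]]] := loc_fracP a; have [b' [t [tp eb]]] := loc_fracP b.
have mem_p c d u : c \in [:: a; b] -> u \notin p -> c * loc_of u = loc_of d -> d \in p.
  move=> cab up e; apply: contra_notT (nu c cab) => /loc_of_unit[v].
  by rewrite -e -mulrA => cv; exists (loc_of u * v).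
exists a', b'; split.
- by apply: (mem_p a _ s); rewrite ?inE ?eqxx.
- by apply: (mem_p b _ t); rewrite ?inE ?eqxx ?orbT.
- move=> x; rewrite -ea => asx0; apply/gen_ideal0.
  apply: (reg 0%N) => //=; apply/gen_ideal0; apply: (loc_of_mulI sp).
  by rewrite mulrAC.
move=> x y; rewrite -ea -eb => e.
have [w] : exists w, loc_of x = w * a.
  apply/gen_ideal1; apply: (reg 1%N) => //=; apply/gen_ideal1.
  have [t' tt'] := loc_of_unit tp; exists (loc_of s * loc_of y * t').
  transitivity (b * loc_of t * loc_of x * t'); last by rewrite e; ring.
  by rewrite -[LHS]mulr1 -tt'; ring.
have [z [v [vp ew]]] := loc_fracP w => ex.
exists z, (s * v); split; first by rewrite prime_idealrM negb_or sp.
by rewrite !rmorphM /= ex -ea -ew; ring.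
Qed.

(* A ring morphism [g] to a domain extends to the localization as soon as it
   does not kill the denominators; its kernel there is then prime. *)
Section KernelPrime.
Variables (D : idomainType) (g : {rmorphism R -> D}).
Hypothesis kerg : forall s, s \notin p -> g s != 0.

Definition loc_ker (z : loc p) : bool := g (repr z).1 == 0.

Lemma loc_kerE a s : loc_ker (\pi_(loc p) (a, s)) = (g a == 0).
Proof.
have gs (w : denom p) : (g (sval w) == 0) = false.
  by apply/negbTE/kerg/(valP w).
have [u /(congr1 g)] := loc_reprP (a, s); rewrite /loc_ker !rmorphM /=.
move=> /(mulfI (kerg (valP u))) e.
apply/eqP/eqP => [z|z]; move: e; rewrite z mul0r; move/eqP.
  by rewrite eq_sym mulf_eq0 gs orbF => /eqP.
by rewrite mulf_eq0 gs orbF => /eqP.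
Qed.

Lemma in_loc_ker z : (z \in loc_ker) = loc_ker z.
Proof. by []. Qed.

Lemma loc_ker_closed : idealr_closed loc_ker.
Proof.
split; rewrite ?in_loc_ker; first by rewrite loc_pi0 /loc_of loc_kerE rmorph0.
  by rewrite loc_pi1 /loc_of loc_kerE rmorph1 oner_eq0.
elim/quotW=> -[a s]; elim/quotW=> -[b t]; elim/quotW=> -[c u].
rewrite !in_loc_ker loc_pi_mul loc_pi_add !loc_kerE /= => /eqP gb /eqP gc.
by rewrite rmorphD !rmorphM /= gb gc !mulr0 !mul0r addr0.
Qed.

Lemma loc_ker_prime : prime_idealr_closed loc_ker.
Proof.
elim/quotW=> -[a s]; elim/quotW=> -[b t].
by rewrite !in_loc_ker loc_pi_mul !loc_kerE /= rmorphM mulf_eq0.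
Qed.

HB.instance Definition _ := isIdealr.Build (loc p) loc_ker loc_ker_closed.
HB.instance Definition _ := isPrimeIdealrClosed.Build (loc p) loc_ker loc_ker_prime.

Definition loc_ker_idealr : prime_idealr (loc p) := loc_ker.

Lemma mem_loc_ker a : (loc_of a \in loc_ker_idealr) = (g a == 0).
Proof. exact: loc_kerE. Qed.

End KernelPrime.

Lemma loc_ker_le (D1 D2 : idomainType) (g1 : {rmorphism R -> D1})
    (g2 : {rmorphism R -> D2}) (kg1 : forall s, s \notin p -> g1 s != 0)
    (kg2 : forall s, s \notin p -> g2 s != 0) :
  (forall a, g1 a = 0 -> g2 a = 0) ->
  {subset loc_ker_idealr kg1 <= loc_ker_idealr kg2}.
Proof.
move=> h z /eqP; rewrite /loc_ker => /h e.
by rewrite unfold_in /loc_ker e.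
Qed.

End LocalizationTheory.

(** * Restriction of polynomials to a set of variables *)

Section Restriction.
Variables (k : fieldType) (n : nat).
Local Notation S := {mpoly k[n]}.
Implicit Types (f g : S) (G H T : {set 'I_n}) (m : 'X_{1..n}).

Lemma mpoly_ring_ind (P : S -> Prop) :
  (forall c, P c%:MP) -> (forall i, P 'X_i) ->
  (forall f g, P f -> P g -> P (f + g)) -> (forall f g, P f -> P g -> P (f * g)) ->
  forall f, P f.
Proof.
move=> PC PX PD PM f; rewrite (mpolyE f).
apply: (big_ind P) => [||m _]; first by have := PC 0; rewrite mpolyC0.
  exact: PD.
rewrite -mul_mpolyC; apply: (PM) => //; rewrite mpolyXE_id.
apply: (big_ind P) => [||i _]; [exact: (PC 1)|exact: PM|].
by elim: (m i) => [|e Pe]; rewrite ?expr0 ?exprS; [exact: (PC 1)|exact: PM].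
Qed.

Lemma mpoly_rmorph_eq (B : comNzRingType) (g1 g2 : {rmorphism S -> B}) :
  (forall c, g1 c%:MP = g2 c%:MP) -> (forall i, g1 'X_i = g2 'X_i) -> g1 =1 g2.
Proof.
move=> eC eX; apply: mpoly_ring_ind => // f g ef eg.
  by rewrite !rmorphD ef eg.
by rewrite !rmorphM ef eg.
Qed.

(** The quotient by the variables outside [G], kept inside the full ring: polynomials in the
    variables of [G] are the fixed points of [restr G], and no ring depends on [G]. *)
Definition restr G : S -> S :=
  mmap (@mpolyC n k) (fun i => if i \in G then 'X_i else 0).

HB.instance Definition _ G := GRing.RMorphism.on (restr G).

Lemma restrC G c : restr G c%:MP = c%:MP.
Proof. exact: mmapC. Qed.

Lemma restrX G i : restr G 'X_i = if i \in G then 'X_i else 0.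
Proof. by rewrite /restr mmapX mmap1U. Qed.

Lemma restrI G H f : restr G (restr H f) = restr (G :&: H) f.
Proof.
apply: (mpoly_rmorph_eq (g1 := restr G \o restr H)) => [c|i] /=.
  by rewrite !restrC.
rewrite !restrX inE; case: (i \in H); rewrite ?andbF ?rmorph0 //.
by rewrite restrX andbT.
Qed.

Lemma restr_sub G H f : G \subset H -> restr G (restr H f) = restr G f.
Proof. by move=> /setIidPl e; rewrite restrI e. Qed.

Lemma restr_id G f : restr G (restr G f) = restr G f.
Proof. exact: restr_sub. Qed.

Lemma restr_le G H f : G \subset H -> restr G f = f -> restr H f = f.
Proof. by move=> /setIidPr e <-; rewrite restrI e. Qed.

Definition mvars m : {set 'I_n} := [set i | m i != 0%N].

Lemma mcoeff_restr G f m : (restr G f)@_m = if mvars m \subset G then f@_m else 0.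
Proof.
have restrXm l : restr G 'X_[l] = if mvars l \subset G then 'X_[l] else 0.
  rewrite mpolyXE_id rmorph_prod /=; case: ifPn => [/subsetP sG|/subsetPn[i]].
    apply: eq_bigr => i _; rewrite rmorphXn /= restrX.
    have [->//|l0] := eqVneq (l i) 0%N.
    by rewrite sG // inE.
  rewrite inE => li iG.
  by rewrite (bigD1 i) //= rmorphXn /= restrX (negPf iG) expr0n (negPf li) mul0r.
rewrite [in RHS](mpolyE f) [in LHS](mpolyE f) rmorph_sum !raddf_sum /=.
have [sG|nsG] := boolP (mvars m \subset G).
  apply: eq_bigr => l _; rewrite -mul_mpolyC rmorphM /= restrC restrXm mul_mpolyC.
  rewrite !mcoeffCM mcoeffZ mcoeffX; case: ifP; rewrite ?mcoeffX // mcoeff0.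
  by have [->|//] := eqVneq l m; rewrite sG.
rewrite big1 // => l _; rewrite -mul_mpolyC rmorphM /= restrC restrXm mcoeffCM.
case: ifP => [sl|]; rewrite ?mcoeff0 ?mulr0 // mcoeffX.
by have [e|] := eqVneq l m; rewrite ?mulr0 //; rewrite -e sl in nsG.
Qed.

Lemma prime_restr (q : S -> Prop) G f : is_prime q ->
  (forall i, i \notin G -> q 'X_i) -> q (f - restr G f).
Proof.
move=> pq qX; elim/mpoly_ring_ind: f => [c|i|f g qf qg|f g qf qg].
- by rewrite restrC subrr; apply: prime0.
- rewrite restrX; case: ifPn => [_|iG]; first by rewrite subrr; apply: prime0.
  by rewrite subr0; apply: qX.
- by rewrite rmorphD opprD addrACA; apply: primeD.
- rewrite (_ : _ - _ = f * (g - restr G g) + (f - restr G f) * restr G g).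
    by apply: (primeD pq); [apply: primeMl|apply: primeMr].
  by rewrite rmorphM /=; ring.
Qed.

Lemma prime_restrE (q : S -> Prop) G f : is_prime q ->
  (forall i, i \notin G -> q 'X_i) -> q (restr G f) <-> q f.
Proof.
move=> pq qX; have qd := prime_restr f pq qX; split=> qf.
  by rewrite -[f](subrK (restr G f)); apply: primeD.
by rewrite -[restr G f](subKr f); apply: primeB.
Qed.

Definition xmon G : S := \prod_(i in G) 'X_i.

Lemma restr_xmon G F : restr G (xmon F) = if F \subset G then xmon F else 0.
Proof.
rewrite rmorph_prod /=; case: ifPn => [/subsetP sF|/subsetPn[i iF iG]].
  by apply: eq_bigr => i iF; rewrite restrX sF.
by rewrite (bigD1 i) //= restrX (negPf iG) mul0r.
Qed.

Lemma X_neq0 i : 'X_i != 0 :> S.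
Proof. by rewrite -msupp_eq0 msuppX. Qed.

Section OneVariable.
Variable y : 'I_n.

(** The coefficients stay in the full ring but no longer involve ['X_y]; evaluation at ['X_y]
    recovers the polynomial. *)
Definition uni_in : S -> {poly S} :=
  mmap (polyC \o @mpolyC n k) (fun i => if i == y then 'X else ('X_i)%:P).

HB.instance Definition _ := GRing.RMorphism.on uni_in.

Lemma uni_inC c : uni_in c%:MP = (c%:MP)%:P.
Proof. exact: mmapC. Qed.

Lemma uni_inX i : uni_in 'X_i = if i == y then 'X else ('X_i)%:P.
Proof. by rewrite /uni_in mmapX mmap1U. Qed.

Lemma uni_inK f : horner_eval 'X_y (uni_in f) = f.
Proof.
apply: (mpoly_rmorph_eq (g1 := horner_eval 'X_y \o uni_in) (g2 := idfun)) => [c|i] /=.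
  by rewrite uni_inC /horner_eval hornerC.
by rewrite uni_inX /horner_eval; case: eqP => [->|_]; rewrite ?hornerX ?hornerC.
Qed.

Lemma uni_in_restr T f :
  map_poly (restr T) (uni_in f) = uni_in (restr (y |: T) f).
Proof.
apply: (mpoly_rmorph_eq (g1 := map_poly (restr T) \o uni_in)
                        (g2 := uni_in \o restr (y |: T))) => [c|i] /=.
  by rewrite restrC !uni_inC map_polyC /= restrC.
rewrite restrX !uni_inX !inE; have [->|iy] := eqVneq i y.
  by rewrite map_polyX uni_inX eqxx.
by rewrite map_polyC /= restrX; case: ifP; rewrite ?uni_inX ?(negPf iy) ?rmorph0.
Qed.

Lemma uni_in_const T f : y \notin T -> uni_in (restr T f) = (restr T f)%:P.
Proof.
move=> yT; apply: (mpoly_rmorph_eq (g1 := uni_in \o restr T)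
                                   (g2 := polyC \o restr T)) => [c|i] /=.
  by rewrite restrC uni_inC.
rewrite restrX; case: ifP => [iT|_]; last by rewrite rmorph0 polyC0.
by rewrite uni_inX; case: eqP yT => // <-; rewrite iT.
Qed.

End OneVariable.

End Restriction.

(** * Polynomials in one variable over a domain *)

Section OneVariableDivisibility.
Variable A : idomainType.

(* If [lead_coef b] is inverted then [b] is monic, hence regular modulo [a]. *)
Lemma lead_coef_dvd (a : A) (b g h : {poly A}) : b * g = a%:P * h ->
  exists N H, lead_coef b ^+ N *: g = a%:P * H.
Proof.
have [sz] := ubnP (size g); elim: sz => // sz IHsz in g h * => ltg e.
have [->|g0] := eqVneq g 0; first by exists 0%N, 0; rewrite scaler0 mulr0.
have [b0|b0] := eqVneq b 0.
  by exists 1%N, 0; rewrite b0 lead_coef0 scale0r mulr0.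
have [d ed] : exists d, lead_coef b * lead_coef g = a * d.
  by rewrite -lead_coefM e; exists h`_(size (a%:P * h)).-1; rewrite lead_coefE coefCM.
pose s := (size g).-1.
(* The corrected polynomial has lost its top coefficient, and the subtracted term is a multiple of
   [a], so an equation of the same form holds for it. *)
have [||N [H eH]] := IHsz (lead_coef b *: g - (a * d) *: 'X^s)
    (lead_coef b *: h - d *: 'X^s * b).
- have szg : (0 < size g)%N by rewrite size_poly_gt0.
  rewrite (leq_trans _ (ltnSE ltg)) // -[size g]prednK // ltnS.
  apply/leq_sizeP => j; rewrite leq_eqVlt => /orP[/eqP<-|ltj].
    by rewrite coefB !coefZ coefXn eqxx mulr1 -ed lead_coefE subrr.
  rewrite coefB !coefZ coefXn gtn_eqF // mulr0 subr0 nth_default ?mulr0 //.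
  by rewrite -[size g]prednK.
- rewrite mulrBr -scalerAr e -!mul_polyC polyCM; ring.
exists N.+1, (H + lead_coef b ^+ N *: (d *: 'X^s)).
rewrite exprSr -scalerA -[lead_coef b *: g](subrK ((a * d) *: 'X^s)) scalerDr eH.
by rewrite mulrDr -!mul_polyC polyCM; congr (_ + _); ring.
Qed.

(* The fibres of [Spec A[x] -> Spec A] are affine lines over a field. *)
Lemma no_chain_in_fibre (q0 q1 q2 : {poly A} -> Prop) :
  is_prime q0 -> is_prime q1 -> is_prime q2 ->
  (forall f, q0 f -> q1 f) -> (forall f, q1 f -> q2 f) ->
  (exists2 f, q1 f & ~ q0 f) -> (exists2 f, q2 f & ~ q1 f) ->
  (forall c, q2 c%:P -> q0 c%:P) -> False.
Proof.
move=> p0 p1 p2 s01 s12 [g1 q1g1 nq0g1] [f2 q2f2 nq1f2] contr.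
have min_ex (q : {poly A} -> Prop) f : q f -> ~ q0 f ->
    exists g, [/\ q g, ~ q0 g & forall h, q h -> (size h < size g)%N -> q0 h].
  have [sz] := ubnP (size f); elim: sz f => // sz IHsz f ltf qf nf.
  have [[h [qh nh lth]]|nex] :=
      pselect (exists h, [/\ q h, ~ q0 h & (size h < size f)%N]).
    by apply: (IHsz h) => //; apply: leq_trans lth _.
  exists f; split=> // h qh lth; apply: contrapT => nh; apply: nex.
  by exists h.
have [f [q2f nq0f minf]] := min_ex q2 f2 q2f2 (fun q0f2 => nq1f2 (s01 _ q0f2)).
have [g [q1g nq0g ming]] := min_ex q1 g1 q1g1 nq0g1.
set c := lead_coef f.
(* Otherwise removing the leading term of [f] would leave a shorter element of [q2], hence one of
   [q0], and [f] would be in [q0]. *)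
have nq0c : ~ q0 c%:P.
  move=> q0c; apply: (nq0f); rewrite -[f](subrK (c%:P * 'X^((size f).-1))).
  have q0cX := primeMr ('X^((size f).-1)) p0 q0c.
  apply: (primeD p0) => //; apply: minf.
    by apply: primeB => //; apply/s12/s01.
  have szf : (0 < size f)%N.
    by rewrite size_poly_gt0; apply: contra_notN nq0f => /eqP->; apply: prime0.
  rewrite -[size f]prednK // ltnS; apply/leq_sizeP => j.
  rewrite leq_eqVlt => /orP[/eqP<-|ltj].
    by rewrite coefB coefCM coefXn eqxx mulr1 -lead_coefE subrr.
  rewrite coefB coefCM coefXn gtn_eqF // mulr0 subr0 nth_default //.
  by rewrite -[size f]prednK.
have nq2c e : ~ q2 (c ^+ e)%:P.
  by move=> /contr; rewrite rmorphXn => /(primeX p0).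
have f0 : f != 0 by apply: contra_notN nq0f => /eqP->; apply: prime0.
have div h : q2 h -> exists e (u r : {poly A}), [/\ (c ^+ e)%:P * h = u * f + r,
    (size r < size f)%N & q0 r].
  move=> q2h; exists (scalp h f), (divp h f), (modp h f).
  have e := Pdiv.Idomain.divp_eq h f; rewrite -mul_polyC -/c in e.
  split=> //; first by rewrite ltn_modp.
  apply: minf; last by rewrite ltn_modp.
  rewrite (_ : (modp h f) = (c ^+ scalp h f)%:P * h - (divp h f) * f).
    by apply: (primeB p2); apply: primeMl.
  by rewrite e addrAC subrr add0r.
(* The pseudo-remainder is too short to lie outside [q0], so [u * f] is in [q1]. If [u] is in [q1],
   minimality of [g] puts [u], hence [g], in [q0]; if [f] is, pseudo-division of [f2] by [f] puts
   [f2] in [q1]. *)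
have [e [u [r [eg szr q0r]]]] := div g (s12 _ q1g).
have q1uf : q1 (u * f).
  rewrite (_ : u * f = (c ^+ e)%:P * g - r); last by rewrite eg addrK.
  by apply: (primeB p1) (s01 _ q0r); apply: primeMl.
case: (prime_or p1 q1uf) => [q1u|q1f].
  have q0u : q0 u.
    apply: ming => //; have [->|u0] := eqVneq u 0.
      rewrite size_poly0 size_poly_gt0.
      by apply: contra_notN nq0g => /eqP->; apply: prime0.
    have szf : (1 < size f)%N.
      rewrite ltnNge; apply: contra_notN nq0f => /size1_polyC ef.
      by rewrite ef; apply: contr; rewrite -ef.
    have szuf : size (u * f) = (size u + size f)%N.-1 by rewrite size_mul.
    have szu : (0 < size u)%N by rewrite size_poly_gt0.
    have : leq (size ((c ^+ e)%:P * g)) (size g).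
      by rewrite mul_polyC; apply: size_scale_leq.
    rewrite eg size_polyDl ?szuf; lia.
  have q0cg : q0 ((c ^+ e)%:P * g).
    by rewrite eg; apply: (primeD p0) => //; apply: primeMr.
  case: (prime_or p0 q0cg) => // q0c; apply: (nq2c e).
  by apply/s12/s01.
apply: nq1f2; have [e' [u' [r' [ef2 _ q0r']]]] := div f2 q2f2.
have : q1 ((c ^+ e')%:P * f2).
  by rewrite ef2; apply: (primeD p1); [apply: primeMl|apply: s01].
by case/(prime_or p1) => // /s12/nq2c.
Qed.

End OneVariableDivisibility.

(** * Gluing polynomials along coordinate subspaces *)

Section Gluing.
Variables (k : fieldType) (n : nat).
Local Notation S := {mpoly k[n]}.

Lemma restr_glue (B : seq {set 'I_n}) (h : {set 'I_n} -> S) :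
  (forall G H, G \in B -> H \in B ->
    restr (G :&: H) (h G) = restr (G :&: H) (h H)) ->
  exists h0, forall G, G \in B -> restr G h0 = restr G (h G).
Proof.
elim: B => [|G B IHB] compat; first by exists 0.
have [|h0 eh0] := IHB.
  by move=> K H KB HB; apply: compat; rewrite inE ?KB ?HB orbT.
(* The correction sets the value on [G]; on the other [H] it vanishes, because [h G] and [h0] both
   agree with [h H] on [G :&: H]. *)
exists (h0 + restr G (h G - h0)) => H; rewrite inE => /orP[/eqP->|HB].
  by rewrite rmorphD /= restr_id rmorphB /= addrC subrK.
rewrite rmorphD /= restrI rmorphB /= setIC compat ?inE ?eqxx ?HB ?orbT //.
rewrite -(restr_sub (h H) (subsetIr G H)) -(restr_sub h0 (subsetIr G H)) eh0 //.
by rewrite subrr addr0.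
Qed.

End Gluing.

(** * Localizations of the Stanley-Reisner ring *)

Section StanleyReisnerRing.
Variables (k : fieldType) (n : nat) (D : simplicial_complex 'I_n).
Local Notation S := {mpoly k[n]}.
Local Notation faces := (D : {set {set 'I_n}}).
Implicit Types (f g : S) (F G H : {set 'I_n}).

Lemma SR_idealP f :
  reflect (forall G, G \in faces -> restr G f = 0) (SR_ideal D f).
Proof.
apply: (iffP (asboolP _)) => [[c ->] G GD|f0].
  rewrite rmorph_sum big1 // => F FD; rewrite rmorphM /= -/(xmon k F) restr_xmon.
  case: ifP => [FG|_]; last by rewrite mulr0.
  by case/negP: FD; apply: faces_sub FG GD.
(* Monomials are grouped by their set of variables; dividing by the squarefree monomial of that set
   lowers each positive exponent by one. *)
exists (fun F => \sum_(m <- msupp f | mvars m == F)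
                    f@_m *: \prod_(i in F) 'X_i ^+ (m i).-1).
rewrite [LHS](mpolyE f) (partition_big (@mvars n) predT) //=.
rewrite (bigID (fun F => F \in faces)) /= big1 ?add0r => [|F FD].
  apply: eq_bigr => F FD; rewrite big_distrl /=; apply: eq_bigr => m /eqP eF.
  rewrite /= -scalerAl -big_split /= mpolyXE_id (bigID (mem F)) /=.
  rewrite [X in _ * X]big1 => [|i].
    rewrite mulr1; congr (_ *: _); apply: eq_bigr => i.
    by rewrite -eF inE -lt0n => mi; rewrite -exprSr prednK.
  by rewrite -eF inE negbK => /eqP->; rewrite expr0.
apply: big1 => m /eqP eF; have := congr1 (mcoeff m) (f0 F FD).
by rewrite mcoeff_restr eF subxx mcoeff0 => ->; rewrite scale0r.
Qed.

Definition SR_of f : SR_ring k D :=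
  \pi_{ideal_quot (SR_ideal D : idealr {mpoly k[n]})} f.

Lemma SR_of_zmod : zmod_morphism SR_of.
Proof. exact: pi_is_zmod_morphism. Qed.

Lemma SR_of_monoid : monoid_morphism SR_of.
Proof. exact: pi_is_monoid_morphism. Qed.

HB.instance Definition _ :=
  GRing.isZmodMorphism.Build {mpoly k[n]} (SR_ring k D) SR_of SR_of_zmod.
HB.instance Definition _ :=
  GRing.isMonoidMorphism.Build {mpoly k[n]} (SR_ring k D) SR_of SR_of_monoid.

Lemma SR_of_eq0 f : SR_of f = 0 <-> SR_ideal D f.
Proof.
have e : SR_ideal D f = (f - 0 \in (SR_ideal D : idealr {mpoly k[n]})).
  by rewrite subr0.
have z : SR_of 0 = 0 by exact: rmorph0.
rewrite e Quotient.idealrBE; split=> [f0|/eqP f0]; last by rewrite /SR_of f0.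
by apply/eqP; rewrite -[RHS]z in f0.
Qed.

Lemma SR_of_surj (x : SR_ring k D) : exists f, x = SR_of f.
Proof. by exists (repr x); rewrite /SR_of reprK. Qed.

Section Point.
Variable p : prime_idealr (SR_ring k D).
Let q f := SR_of f \in p.

Definition vertex_support : {set 'I_n} := [set i | SR_of 'X_i \notin p].
Local Notation F := vertex_support.

Lemma point_prime : is_prime (fun f => SR_of f \in p).
Proof. exact: (is_prime_preim SR_of (is_prime_idealr p)). Qed.
Let pq : is_prime q := point_prime.

Lemma notin_support i : i \notin F -> SR_of 'X_i \in p.
Proof. by rewrite inE negbK. Qed.

Lemma xmon_support : SR_of (xmon k F) \notin p.
Proof.
by apply/negP => /(prime_prod pq)[i]; rewrite inE => /negP.
Qed.

(** The monomial of a nonface is zero in the quotient, while that of [F] is a product of elements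
    outside [p]. *)
Lemma support_face : F \in faces.
Proof.
apply: contraNT xmon_support => FD; rewrite (_ : SR_of _ = 0) ?idealr0 //.
apply/SR_of_eq0/SR_idealP => G GD; rewrite restr_xmon; case: ifP => // FG.
by case/negP: FD; apply: faces_sub FG GD.
Qed.

Lemma mem_restr G f : F \subset G -> (SR_of (restr G f) \in p) = (SR_of f \in p).
Proof.
move=> /subsetP FG; apply/idP/idP => /(prime_restrE f pq) h; apply: h => i iG;
  by apply: notin_support; apply: contra iG => /FG.
Qed.

Lemma restr_neq0 G f : F \subset G -> SR_of f \notin p -> restr G f != 0.
Proof.
move=> FG; apply: contraNneq => f0; rewrite -(mem_restr _ FG) f0 rmorph0.
exact: idealr0.
Qed.

(** Equality in the localization can be tested on any family dominating the star of [F]; each case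
    below picks one on whose members the chosen elements are regular. *)
Definition covering (B : {set {set 'I_n}}) : Prop :=
  (forall G, G \in B -> G \in faces /\ F \subset G) /\
  (forall G, G \in faces -> F \subset G -> exists2 H, H \in B & G \subset H).

Lemma covering_star : covering [set G in faces | F \subset G].
Proof.
split=> [G|G GD FG]; first by rewrite inE => /andP[].
by exists G; rewrite // inE GD.
Qed.

Section Covering.
Variables (B : {set {set 'I_n}}).
Hypothesis covB : covering B.

Lemma loc_SR_eq0 f :
  loc_of p (SR_of f) = 0 <-> forall G, G \in B -> restr G f = 0.
Proof.
rewrite loc_of_eq0; split=> [[u up uf0] G /(proj1 covB)[GD FG]|f0].
  have [v ev] := SR_of_surj u; rewrite ev in up uf0.
  move: uf0; rewrite -rmorphM => /SR_of_eq0/SR_idealP/(_ G GD)/eqP.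
  by rewrite rmorphM mulf_eq0 (negPf (restr_neq0 FG up)) => /eqP.
(* The monomial of [F] is a denominator that vanishes on every face not containing [F]. *)
exists (SR_of (xmon k F)); first exact: xmon_support.
rewrite -rmorphM; apply/SR_of_eq0/SR_idealP => G GD; rewrite rmorphM /= restr_xmon.
case: ifP => [FG|]; last by rewrite mul0r.
have [H HB GH] := (proj2 covB) G GD FG.
by rewrite -(restr_sub f GH) f0 // rmorph0 mulr0.
Qed.

Lemma loc_SR_eq f g :
  loc_of p (SR_of f) = loc_of p (SR_of g) <->
  forall G, G \in B -> restr G f = restr G g.
Proof.
split=> [e G GB|e].
  apply/eqP; rewrite -subr_eq0 -rmorphB; apply/eqP.
  by apply: (proj1 (loc_SR_eq0 _)) => //; rewrite !rmorphB /= e subrr.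
apply/eqP; rewrite -subr_eq0 -!rmorphB; apply/eqP/loc_SR_eq0 => G GB.
by rewrite rmorphB /= e // subrr.
Qed.

Lemma loc_SR_nzd a : (forall G, G \in B -> restr G a != 0) ->
  forall x, loc_of p (SR_of a) * loc_of p x = 0 -> loc_of p x = 0.
Proof.
move=> a0 x; have [f ->] := SR_of_surj x.
rewrite -!rmorphM => /loc_SR_eq0 af0; apply/loc_SR_eq0 => G GB.
apply/eqP; have /eqP := af0 G GB.
by rewrite rmorphM mulf_eq0 (negPf (a0 G GB)).
Qed.

Lemma SR_depth1 a : SR_of a \in p -> (forall G, G \in B -> restr G a != 0) ->
  depth_geq (loc p) 1.
Proof. by move=> ap /loc_SR_nzd; apply: depth_geq1. Qed.

Lemma SR_depth2 a b : SR_of a \in p -> SR_of b \in p ->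
  (forall G, G \in B -> restr G a != 0) ->
  (forall f g, (forall G, G \in B -> restr G (b * f) = restr G (a * g)) ->
    exists h w, SR_of w \notin p /\
      forall G, G \in B -> restr G (w * f) = restr G (a * h)) ->
  depth_geq (loc p) 2.
Proof.
move=> ap bp a0 reg; apply: (depth_geq2 ap bp); first exact: loc_SR_nzd.
move=> x y; have [f ->] := SR_of_surj x; have [g ->] := SR_of_surj y.
rewrite -!rmorphM /= => /loc_SR_eq/reg[h [w [wp e]]].
have [t wt] := loc_of_unit wp; exists (t * loc_of p (SR_of h)).
have /loc_SR_eq := e; rewrite !rmorphM /= => e'.
by rewrite -[LHS]mul1r -wt [_ * t]mulrC -[LHS]mulrA e'; ring.
Qed.

End Covering.

End Point.

End StanleyReisnerRing.

Section LinkConnectivity.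
Variables (n : nat) (D : {set {set 'I_n}}).

Definition link_edge (F : {set 'I_n}) : rel 'I_n :=
  fun v w => [&& v \notin F, w \notin F, v != w & F :|: [set v; w] \in D].

(** The edge from [v0] to [w0] encodes that the link has dimension at least 1; a complex is
    connected exactly when its 1-skeleton is. *)
Definition links_connected : Prop :=
  forall F v0 w0 v w, link_edge F v0 w0 ->
    v \notin F -> v |: F \in D -> w \notin F -> w |: F \in D ->
    connect (link_edge F) v w.

End LinkConnectivity.

(** * Regularity and chains of primes seen through one variable *)

Section OneVariableTransfer.
Variables (A : idomainType) (x : A) (phi : {rmorphism A -> {poly A}}).
Hypothesis phiK : forall f, (phi f).[x] = f.

Lemma lead_coef_reg a b f g : phi a = a%:P -> b * f = a * g ->
  exists N h, lead_coef (phi b) ^+ N * f = a * h.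
Proof.
move=> ea /(congr1 phi); rewrite !rmorphM /= ea => /lead_coef_dvd[N [H e]].
exists N, H.[x]; move/(congr1 (fun p : {poly A} => p.[x])): e.
by rewrite hornerZ phiK hornerCM.
Qed.

(** Modulo [a] the variable becomes [- e]. As [b] does not vanish there, [f] does, and the factor
    theorem applies. *)
Lemma linear_reg a e b f g : phi a = 'X + e%:P -> (phi b).[- e] != 0 ->
  b * f = a * g -> exists h, f = a * h.
Proof.
move=> ea be /(congr1 phi); rewrite !rmorphM /= ea => ebf.
have := congr1 (fun p : {poly A} => p.[- e]) ebf.
rewrite !hornerM hornerD hornerX hornerC addNr mul0r => /eqP.
rewrite mulf_eq0 (negPf be) => /factor_theorem[s es]; exists s.[x].
by rewrite -[LHS]phiK es hornerM mulrC -[a in RHS]phiK ea polyCN opprK.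
Qed.

Lemma no_chain_one_variable (rT rG : {rmorphism A -> A}) (q0 q1 q2 : A -> Prop) :
  (forall f, map_poly rT (phi f) = phi (rG f)) ->
  is_prime q0 -> is_prime q1 -> is_prime q2 ->
  (forall f, q0 f -> q1 f) -> (forall f, q1 f -> q2 f) ->
  (exists2 f, q1 (rG f) & ~ q0 (rG f)) -> (exists2 f, q2 (rG f) & ~ q1 (rG f)) ->
  (forall f, q2 (rT f) -> rT f = 0) -> False.
Proof.
move=> rTG p0 p1 p2 s01 s12 [f1 q1f1 nq0f1] [f2 q2f2 nq1f2] zT.
(* Since [psi] composed with [phi] is [rG], the primes pulled back along [psi] still form a strict
   chain; on constants [psi] is [rT], so [zT] controls their contractions. *)
pose psi := horner_eval x \o map_poly rT.
have psi_phi f : psi (phi f) = rG f by rewrite /psi /= rTG /horner_eval phiK.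
apply: (@no_chain_in_fibre _ (q0 \o psi) (q1 \o psi) (q2 \o psi)).
- exact: is_prime_preim.
- exact: is_prime_preim.
- exact: is_prime_preim.
- by move=> f; apply: s01.
- by move=> f; apply: s12.
- by exists (phi f1); rewrite /= psi_phi.
- by exists (phi f2); rewrite /= psi_phi.
- move=> c; rewrite /= /psi /= map_polyC /horner_eval /= hornerC => /zT->.
  exact: prime0.
Qed.

End OneVariableTransfer.

Section Polynomials.
Variables (k : fieldType) (n : nat).
Local Notation S := {mpoly k[n]}.
Implicit Types (a b f g : S) (G J T : {set 'I_n}).

Definition sumX J : S := \sum_(i in J) 'X_i.

Lemma restr_sumX G J : restr G (sumX J) = sumX (G :&: J).
Proof.
rewrite rmorph_sum /= (eq_bigr _ (fun i _ => restrX k G i)) -big_mkcondr /=.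
by apply: eq_bigl => i; rewrite inE andbC.
Qed.

Lemma sumX_neq0 J v : v \in J -> sumX J != 0.
Proof.
move=> vJ; apply/eqP => /(congr1 (mcoeff U_(v))) /eqP.
rewrite raddf_sum mcoeff0 (bigD1 v) //= mcoeffXU eqxx big1 ?addr0 ?oner_eq0 // => i.
by case/andP=> _ iv; rewrite mcoeffXU (negPf iv).
Qed.

Lemma uni_in_sumX J y : y \in J ->
  uni_in y (sumX J) = 'X + (sumX (J :\ y))%:P.
Proof.
move=> yJ; rewrite {1}/sumX rmorph_sum (bigD1 y) //= uni_inX eqxx; congr (_ + _).
rewrite rmorph_sum /=; apply: eq_big => [i|i]; first by rewrite !inE andbC.
by case/andP=> _ iy; rewrite uni_inX (negPf iy).
Qed.

Lemma restr_set0 f : exists c, restr set0 f = c%:MP.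
Proof.
exists f@_0; apply/mpolyP => m; rewrite mcoeff_restr mcoeffC subset0.
have [e|] := eqVneq (mvars m) set0.
  suff -> : m = 0%MM by rewrite eqxx mulr1.
  by apply/mnmP => i; rewrite mnm0E; have := in_set0 i; rewrite -e inE => /eqP.
have [->|_ _] := eqVneq m 0%MM; last by rewrite mulr0.
by case/eqP; apply/setP => i; rewrite !inE mnm0E.
Qed.

Lemma lead_coef_restr y T b : restr (y |: T) b = b ->
  restr T (lead_coef (uni_in y b)) = lead_coef (uni_in y b).
Proof.
by move=> bT; rewrite !lead_coefE -coef_map [map_poly _ _]uni_in_restr bT.
Qed.

Lemma uni_in_eq0 y b : uni_in y b = 0 -> b = 0.
Proof. by move=> b0; rewrite -[b](uni_inK y) b0 rmorph0. Qed.

Lemma uni_in_horner y f : (uni_in y f).['X_y] = f.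
Proof. exact: uni_inK. Qed.

(** Once the variables outside [y |: T] are killed, all three primes lie over zero in the polynomial
    ring on [T], hence in a fibre of dimension at most 1. *)
Lemma no_chain_over y T (q0 q1 q2 : S -> Prop) :
  is_prime q0 -> is_prime q1 -> is_prime q2 ->
  (forall f, q0 f -> q1 f) -> (forall f, q1 f -> q2 f) ->
  (exists2 f, q1 f & ~ q0 f) -> (exists2 f, q2 f & ~ q1 f) ->
  (forall i, i \notin y |: T -> q0 'X_i) ->
  (forall f, q2 (restr T f) -> restr T f = 0) -> False.
Proof.
move=> p0 p1 p2 s01 s12 [f1 q1f1 nq0f1] [f2 q2f2 nq1f2] X0 zT.
have X1 i : i \notin y |: T -> q1 'X_i by move/X0/s01.
have X2 i : i \notin y |: T -> q2 'X_i by move/X1/s12.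
apply: (no_chain_one_variable (uni_in_horner y) (uni_in_restr y T) p0 p1 p2) => //.
- by exists f1; rewrite prime_restrE.
- by exists f2; rewrite prime_restrE.
Qed.

(* Modulo [sumX J] one may substitute [-] the remaining variables for [X_y];
   sending all of those but [X_z] to 0, [\sum_i X_i ^+ i.+1] becomes
   [(- X_z) ^+ y.+1 + X_z ^+ z.+1]. *)
Lemma sumX_power_reg J y z f g : y \in J -> z \in J -> y != z ->
  (\sum_(i in J) 'X_i ^+ i.+1) * f = sumX J * g -> exists h, f = sumX J * h.
Proof.
move=> yJ zJ yz; apply: (linear_reg (uni_in_horner y) (uni_in_sumX yJ)).
pose theta : {rmorphism S -> {poly k}} :=
  mmap polyC (fun i => if i == z then 'X else 0).
have thetaX i : theta 'X_i = if i == z then 'X else 0.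
  by rewrite /theta /= mmapX mmap1U.
set e := sumX _; have te : theta e = 'X.
  rewrite rmorph_sum (bigD1 z) /=; last by rewrite !inE eq_sym yz.
  rewrite thetaX eqxx big1 ?addr0 // => i /andP[_ iz].
  by rewrite thetaX (negPf iz).
have [tau tauX tau0] : exists2 tau : {rmorphism S -> {poly k}},
    forall i, tau 'X_i = if i == y then - 'X else if i == z then 'X else 0
  & forall f, (uni_in y f).[- e] = 0 -> tau f = 0.
  exists ((theta \o horner_eval (- e)) \o uni_in y) => [i|f0] /=.
    rewrite uni_inX /horner_eval; case: eqP => _; first by rewrite hornerX rmorphN te.
    by rewrite hornerC thetaX.
  by rewrite /horner_eval => ->; rewrite rmorph0.
apply: contra_neq (_ : tau (\sum_(i in J) 'X_i ^+ i.+1) != 0) => [/tau0//|].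
rewrite rmorph_sum (bigD1 y) //= (bigD1 z) /=; last by rewrite zJ eq_sym.
rewrite big1 => [|i /andP[/andP[_ iy] iz]]; last first.
  by rewrite rmorphXn /= tauX (negPf iy) (negPf iz) expr0n.
rewrite !rmorphXn /= !tauX !eqxx [z == y]eq_sym (negPf yz) addr0.
(* The two powers of ['X] have degrees [y.+1] and [z.+1]; this is why the exponents in the sum are
   pairwise distinct. *)
rewrite addr_eq0; apply/eqP => /(congr1 (fun p : {poly k} => size p)).
rewrite size_polyN exprNn size_Msign !size_polyXn => -[] /ord_inj.
by move/eqP: yz.
Qed.

End Polynomials.

(** * Connected links imply depth at least 2 *)

Section Depth.
Variables (k : fieldType) (n : nat) (D : simplicial_complex 'I_n).
Variable p : prime_idealr (SR_ring k D).
Local Notation S := {mpoly k[n]}.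
Local Notation faces := (D : {set {set 'I_n}}).
Local Notation F := (vertex_support p).
Local Notation q := (fun f => SR_of D f \in p).
Implicit Types (f g a b : S) (G H T : {set 'I_n}).

Lemma SR_chain r : krull_dim_geq (loc p) r -> exists Q : nat -> S -> Prop,
  [/\ forall i, is_prime (Q i), forall i f, SR_ideal D f -> Q i f,
   forall i f, Q i f -> q f &
   forall i, (i < r)%N ->
     (forall f, Q i f -> Q i.+1 f) /\ exists2 f, Q i.+1 f & ~ Q i f].
Proof.
move=> /loc_chain[Q [pQ Qp Qlt]]; exists (fun i => Q i \o SR_of D); split.
- by move=> i; apply: is_prime_preim.
- by move=> i f /SR_of_eq0 /= ->; apply: prime0.
- by move=> i f /= /Qp.
- move=> i /Qlt[sQ [x Qx nQx]]; split=> [f|]; first exact: sQ.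
  by have [f ef] := SR_of_surj x; exists f; rewrite /= -ef.
Qed.

(** The monomial of [i |: G] is zero in the quotient, so the prime contains one of its variables. *)
Lemma nonface_var (Q : S -> Prop) G i :
  is_prime Q -> (forall f, SR_ideal D f -> Q f) ->
  i |: G \notin faces -> (forall j, j \in G -> ~ Q 'X_j) -> Q 'X_i.
Proof.
move=> pQ IQ iGD GQ.
have : Q (xmon k (i |: G)).
  apply/IQ/SR_idealP => H HD; rewrite restr_xmon; case: ifP => // sH.
  by case/negP: iGD; apply: faces_sub sH HD.
move=> /(prime_prod pQ)[j]; rewrite !inE => /orP[/eqP->//|jG].
by move/(GQ _ jG).
Qed.

Lemma support_notin (Q : S -> Prop) i :
  (forall f, Q f -> q f) -> i \in F -> ~ Q 'X_i.
Proof. by move=> sQ; rewrite inE => /negP nq /sQ. Qed.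

(* [p] lies over the zero ideal of the polynomial ring in the [X_i], [i \in T]. *)
Definition zero_on T : Prop := forall f, q (restr T f) -> restr T f = 0.

Lemma zero_on_set0 : zero_on set0.
Proof.
move=> f; have [c ->] := restr_set0 f; have [->//|c0] := eqVneq c 0.
move=> qc; case: (prime1 (point_prime p)).
have -> : 1 = c^-1%:MP * c%:MP :> S by rewrite -mpolyCM mulVf.
exact: (primeMl (point_prime p)).
Qed.

Definition facet G := forall i, i \notin G -> i |: G \notin faces.

(** Every prime below [p] contains the variables outside a facet, and [zero_on F] says that these
    generate [p]: it is a minimal prime. *)
Lemma facet_dim0 : facet F -> zero_on F -> ~ krull_dim_geq (loc p) 1.
Proof.
move=> fF zF /SR_chain[Q [pQ IQ Qq /(_ 0 isT)[s01 [f Q1f]]]]; apply.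
have X0 i : i \notin F -> Q 0%N 'X_i.
  move=> /fF iF; apply: (nonface_var (pQ 0%N) (IQ 0%N) iF) => j.
  by apply: support_notin; apply: Qq.
apply/(prime_restrE f (pQ 0%N) X0).
have -> : restr F f = 0; last exact: prime0.
by apply: zF; rewrite mem_restr //; apply: Qq Q1f.
Qed.

Lemma facet_dim1 T y : facet F -> F = y |: T -> zero_on T ->
  ~ krull_dim_geq (loc p) 2.
Proof.
move=> fF eF zT /SR_chain[Q [pQ IQ Qq Qlt]].
have [s01 ne01] := Qlt 0%N isT; have [s12 ne12] := Qlt 1%N isT.
apply: (no_chain_over (pQ 0%N) (pQ 1%N) (pQ 2%N) s01 s12 ne01 ne12 (T := T) (y := y)).
  rewrite -eF => i /fF iF.
  by apply: (nonface_var (pQ 0%N) (IQ 0%N) iF) => j; apply: support_notin; apply: Qq.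
by move=> f /Qq; apply: zT.
Qed.

(** Some ['X_v] with [v] outside [F] is not in [Q 1], otherwise [Q 1] contains [p]. Without edges in
    the link, [Q 0] then contains every other ['X_w] outside [F], and only the variable [v] is left
    over [F]. *)
Lemma edgeless_dim1 : zero_on F -> (forall v w, ~~ link_edge faces F v w) ->
  ~ krull_dim_geq (loc p) 2.
Proof.
move=> zF noE /SR_chain[Q [pQ IQ Qq Qlt]].
have [s01 ne01] := Qlt 0%N isT; have [s12 ne12] := Qlt 1%N isT.
have qF f : q f -> restr F f = 0 by move=> qf; apply: zF; rewrite mem_restr.
have [v vF nQv] : exists2 v, v \notin F & ~ Q 1%N 'X_v.
  apply: contrapT => nex; case: ne12 => f /Qq/qF f0; apply.
  have X1 i : i \notin F -> Q 1%N 'X_i.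
    by move=> iF; apply: contrapT => nQi; apply: nex; exists i.
  by apply/(prime_restrE f (pQ 1%N) X1); rewrite f0; apply: prime0.
apply: (no_chain_over (pQ 0%N) (pQ 1%N) (pQ 2%N) s01 s12 ne01 ne12 (T := F) (y := v)).
  move=> w; rewrite in_setU1 negb_or => /andP[wv wF].
  apply: (nonface_var (pQ 0%N) (IQ 0%N) (G := v |: F)); last first.
    move=> j; rewrite in_setU1 => /orP[/eqP-> /s01//|jF].
    by apply: support_notin jF; apply: Qq.
  have -> : w |: (v |: F) = F :|: [set w; v] by rewrite setUA setUC.
  by have := noE w v; rewrite /link_edge wF vF wv.
by move=> f /Qq; apply: zF.
Qed.

Lemma facet_covering : facet F -> covering p [set F].
Proof.
move=> fF; split=> [G|G GD FG].
  by rewrite inE => /eqP ->; split=> //; apply: support_face.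
exists F; first by rewrite inE.
apply/subsetP => i iG; apply: contraT => /fF/negP[].
by apply: faces_sub GD; rewrite subUset sub1set iG.
Qed.

(** If [F] is not a facet, dropping [F] from its star still leaves a covering, and [sumX k (~: F)]
    is nonzero on each remaining face. *)
Definition proper_star : {set {set 'I_n}} := [set G in faces | F \proper G].

Lemma proper_covering : ~ facet F -> covering p proper_star.
Proof.
move=> nfF; split=> [G|G GD FG].
  by rewrite inE => /andP[GD /proper_sub].
have [eFG|nFG] := eqVneq F G; last first.
  by exists G; rewrite // inE GD properEneq nFG.
have [i iF iFD] : exists2 i, i \notin F & i |: F \in faces.
  apply: contrapT => nex; apply: nfF => i iF; apply/negP => iFD; apply: nex.
  by exists i.
exists (i |: F); last by rewrite -eFG subsetUr.
rewrite inE iFD; apply/properP; split; first exact: subsetUr.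
by exists i; rewrite ?setU11.
Qed.

Lemma proper_starP G : G \in proper_star ->
  [/\ G \in faces, F \subset G & exists2 v, v \in G & v \notin F].
Proof. by rewrite inE => /andP[GD /properP[]]. Qed.

Lemma sumX_in : q (sumX k (~: F)).
Proof.
apply: (prime_sum _ (point_prime p)) => i; rewrite in_setC; exact: notin_support.
Qed.

Lemma restr_sumX_neq0 G v : v \in G -> v \notin F -> restr G (sumX k (~: F)) != 0.
Proof.
by move=> vG vF; rewrite restr_sumX; apply: (@sumX_neq0 _ _ _ v);
  rewrite in_setI in_setC vG.
Qed.

Lemma depth1 : krull_dim_geq (loc p) 1 -> depth_geq (loc p) 1.
Proof.
move=> dim1; have [fF|nfF] := pselect (facet F); last first.
  apply: (SR_depth1 (proper_covering nfF) sumX_in) => G /proper_starP[_ _ [v]].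
  exact: restr_sumX_neq0.
have [f qf f0] : exists2 f, q (restr F f) & restr F f <> 0.
  apply: contrapT => nex; apply: (facet_dim0 fF) dim1 => f qf.
  by apply: contrapT => f0; apply: nex; exists f.
apply: (SR_depth1 (facet_covering fF) qf) => G; rewrite inE => /eqP->.
by rewrite restr_id; apply/eqP.
Qed.

Lemma depth2_facet : facet F -> krull_dim_geq (loc p) 2 -> depth_geq (loc p) 2.
Proof.
move=> fF dim2.
pose zP T := (T \subset F) && `[< zero_on T >].
have zP0 : zP set0 by rewrite /zP sub0set; apply/asboolP/zero_on_set0.
have [T /maxsetP[/andP[TF /asboolP zT] maxT] _] := maxset_exists zP0.
(* Dimension at least 1 excludes [T = F], and dimension at least 2 excludes that [T] misses a single
   vertex of [F]. *)
have neTF : T != F.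
  apply/eqP => eTF; apply: (facet_dim0 fF); first by rewrite -eTF.
  by case: dim2 => P hP; exists P => i i1; apply: hP; apply: leq_trans i1 _.
have [y1 y1F y1T] : exists2 y, y \in F & y \notin T.
  by apply/subsetPn; move: neTF; rewrite eqEsubset TF.
have [y2 /setD1P[y21 y2F] y2T] : exists2 y, y \in F :\ y1 & y \notin T.
  apply/subsetPn/negP => sFT; apply: (facet_dim1 fF _ zT dim2 (y := y1)).
  by apply/eqP; rewrite eqEsubset subUset sub1set y1F TF -subDset sFT.
(* By maximality of [T], each further variable satisfies an algebraic equation over [T] modulo
   [p]. *)
have wit y : y \in F -> y \notin T ->
    exists2 a, q (restr (y |: T) a) & restr (y |: T) a <> 0.
  move=> yF yT; apply: contrapT => nex.
  have : y |: T = T.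
    apply: maxT (subsetUr _ _); rewrite /zP subUset sub1set yF TF /=.
    apply/asboolP => a qa; apply: contrapT => a0; apply: nex; by exists a.
  by move/setP/(_ y); rewrite setU11 (negPf yT).
have [a qa a0] := wit y1 y1F y1T; have [b qb b0] := wit y2 y2F y2T.
set a' := restr _ a in qa a0; set b' := restr _ b in qb b0.
have sF y : y \in F -> y |: T \subset F by move=> yF; rewrite subUset sub1set yF.
have aF : restr F a' = a' by apply: restr_le (sF _ y1F) (restr_id _ _).
have bF : restr F b' = b' by apply: restr_le (sF _ y2F) (restr_id _ _).
apply: (SR_depth2 (facet_covering fF) qa qb).
  by move=> G; rewrite inE => /eqP->; rewrite aF; apply/eqP.
move=> f g /(_ F); rewrite inE eqxx => /(_ isT); rewrite !rmorphM /= aF bF => e.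
(* [a'] does not involve ['X_y2], so [b'] is regular modulo [a'] once its leading coefficient in
   ['X_y2] is inverted. That coefficient involves only [T] and is nonzero, hence lies outside
   [p]. *)
have ua : uni_in y2 a' = a'%:P.
  by apply: uni_in_const; rewrite in_setU1 negb_or y21.
have [N [h eh]] := lead_coef_reg (uni_in_horner y2) ua e.
exists h, (lead_coef (uni_in y2 b') ^+ N); split.
  apply/negP => /(primeX (point_prime p)).
  have lT : restr T (lead_coef (uni_in y2 b')) = lead_coef (uni_in y2 b').
    by apply: lead_coef_restr; apply: restr_id.
  rewrite -lT => /zT; rewrite lT => /eqP; rewrite lead_coef_eq0 => /eqP/uni_in_eq0.
  exact: b0.
move=> G; rewrite inE => /eqP->.
by rewrite rmorphM /= -(restr_id F f) -rmorphM eh.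
Qed.

(** The quotients by [a] found on single faces glue to one polynomial by [restr_glue], with
    denominator 1. *)
Lemma SR_depth2_glue (B : {set {set 'I_n}}) a b : covering p B -> q a -> q b ->
  (forall G, G \in B -> restr G a != 0) ->
  (forall G f g, G \in B -> restr G b * f = restr G a * g ->
    exists h, f = restr G a * h) ->
  (forall f (h : {set 'I_n} -> S),
    (forall G, G \in B -> restr G f = restr G a * h G) ->
    forall G H, G \in B -> H \in B ->
      restr (G :&: H) (h G) = restr (G :&: H) (h H)) ->
  depth_geq (loc p) 2.
Proof.
move=> covB qa qb a0 reg compat; apply: (SR_depth2 covB qa qb a0) => f g e.
have [|h eh] := @choice _ _ (fun G u => G \in B -> restr G f = restr G a * u).
  move=> G.
  have [GB|_] := boolP (G \in B); last by exists 0.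
  have [|u eu] := reg G (restr G f) (restr G g) GB; last by exists u.
  by have := e G GB; rewrite !rmorphM.
have [|h0 eh0] := @restr_glue _ _ (enum B) h.
  by move=> G H; rewrite !mem_enum; apply: (compat f).
exists h0, 1; split; first by rewrite rmorph1 idealr1.
move=> G GB; rewrite mul1r rmorphM /= eh0 ?mem_enum //.
by rewrite -[LHS]restr_id eh // rmorphM /= restr_id.
Qed.

Lemma restr_quot_eq (K G H : {set 'I_n}) f a (u v : S) :
  K \subset G -> K \subset H ->
  restr K a != 0 -> restr G f = restr G a * u -> restr H f = restr H a * v ->
  restr K u = restr K v.
Proof.
move=> KG KH a0 eu ev; apply: (mulfI a0); transitivity (restr K f).
  by rewrite -(restr_sub f KG) eu rmorphM /= restr_sub.
by rewrite -(restr_sub f KH) ev rmorphM /= restr_sub.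
Qed.

(** An element [a] in the variables of [F] stays nonzero on every overlap, since overlaps contain
    [F]; cancelling it makes the quotients compatible. *)
Lemma depth2_transversal : ~ facet F -> ~ zero_on F -> depth_geq (loc p) 2.
Proof.
move=> nfF nzF.
have [a0 qa a0n] : exists2 f, q (restr F f) & restr F f <> 0.
  apply: contrapT => nex; apply: nzF => f qf.
  by apply: contrapT => f0; apply: nex; exists f.
set a := restr F a0 in qa a0n.
have aG G : F \subset G -> restr G a = a.
  by move=> FG; apply: restr_le FG (restr_id _ _).
have an G : F \subset G -> restr G a != 0 by move/aG->; apply/eqP.
apply: (SR_depth2_glue (proper_covering nfF) qa sumX_in).
- by move=> G /proper_starP[_ /an].
- move=> G f g /proper_starP[_ FG [y yG yF]]; rewrite aG // => e.
  have ua : uni_in y a = a%:P by apply: uni_in_const.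
  have [N [h]] := lead_coef_reg (uni_in_horner y) ua e.
  (* The sum is monic in ['X_y], so the power of its leading coefficient is 1. *)
  rewrite restr_sumX /= uni_in_sumX ?lead_coefXaddC ?expr1n ?mul1r; first by exists h.
  by rewrite in_setI in_setC yG.
- move=> f h eh G H GB HB.
  have [_ FG _] := proper_starP GB; have [_ FH _] := proper_starP HB.
  apply: (restr_quot_eq (subsetIl G H) (subsetIr G H) _ (eh G GB) (eh H HB)).
  by apply: an; rewrite subsetI FG.
Qed.

Lemma depth2_origin : links_connected faces -> zero_on F ->
  krull_dim_geq (loc p) 2 -> depth_geq (loc p) 2.
Proof.
move=> conn zF dim2.
have [v0 [w0 e0]] : exists v w, link_edge faces F v w.
  apply: contrapT => nex; apply: (edgeless_dim1 zF) dim2 => v w.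
  by apply/negP => e; apply: nex; exists v, w.
(* Each face of [B] has two vertices outside [F], as [sumX_power_reg] demands. *)
pose B := [set G in faces | [exists v, exists w,
  link_edge faces F v w && (F :|: [set v; w] \subset G)]].
have edgeB v w : link_edge faces F v w -> F :|: [set v; w] \in B.
  move=> e; rewrite inE; case/and4P: (e) => _ _ _ -> /=.
  by apply/existsP; exists v; apply/existsP; exists w; rewrite e subxx.
have BP G : G \in B -> [/\ G \in faces, F \subset G & exists v w,
    [/\ v \in G :\: F, w \in G :\: F & v != w]].
  rewrite inE => /andP[GD /existsP[v /existsP[w /andP[/and4P[vF wF vw _] sG]]]].
  have [FG vwG] := andP (etrans (esym (subUset _ _ _)) sG).
  split=> //; exists v, w; rewrite !in_setD vF wF; split=> //=;
    by apply: (subsetP vwG); rewrite in_set2 eqxx ?orbT.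
have covB : covering p B.
  split=> [G /BP[]//|G GD FG].
  have [/existsP[v /existsP[w /and3P[]]]|nE] :=
      boolP [exists v, exists w, [&& v \in G :\: F, w \in G :\: F & v != w]].
    rewrite !in_setD => /andP[vF vG] /andP[wF wG] vw; exists G => //.
    rewrite inE GD; apply/existsP; exists v; apply/existsP; exists w.
    have sG : F :|: [set v; w] \subset G.
      by rewrite !subUset FG !sub1set vG wG.
    by rewrite sG andbT /link_edge vF wF vw (faces_sub sG GD).
  have [eG|[v]] := set_0Vmem (G :\: F).
    exists (F :|: [set v0; w0]); first exact: edgeB.
    by apply: subset_trans (subsetUl _ _); rewrite -setD_eq0 eG.
  rewrite in_setD => /andP[vF vG].
  have sG : G \subset v |: F.
    apply/subsetP => i iG; rewrite in_setU1.
    have [//|iF] := boolP (i \in F); rewrite ?orbT // orbF.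
    apply: contraNT nE => iv; apply/existsP; exists i; apply/existsP; exists v.
    by rewrite !in_setD iF iG vF vG iv.
  have vFD : v |: F \in faces by apply: faces_sub GD; rewrite subUset sub1set vG.
  (* If [G] adds only [v] to [F], an edge at [v] is wanted: some endpoint of the given edge differs
     from [v], and a path from [v] to it starts with such an edge. *)
  have [w /andP[wF wFD] wv] : exists2 w, (w \notin F) && (w |: F \in faces) & w != v.
    case/and4P: e0 => v0F w0F vw0 D0.
    have [ev|] := eqVneq v0 v.
      exists w0; last by rewrite -ev eq_sym.
      by rewrite w0F; apply: faces_sub D0;
        rewrite subUset subsetUl sub1set !in_setU !in_set1 eqxx !orbT.
    exists v0 => //.
    by rewrite v0F; apply: faces_sub D0;
        rewrite subUset subsetUl sub1set !in_setU !in_set1 eqxx !orbT.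
  have /connectP[[|u s] /= pth lst] := conn _ _ _ _ _ e0 vF vFD wF wFD.
    by rewrite lst eqxx in wv.
  case/andP: pth => vu _; exists (F :|: [set v; u]); first exact: edgeB.
  apply: subset_trans sG _; rewrite subUset subsetUl andbT sub1set.
  by rewrite !in_setU !in_set1 eqxx orbT.
pose b : S := \sum_(i in ~: F) 'X_i ^+ i.+1.
have qb : q b.
  apply: (prime_sum _ (point_prime p)) => i; rewrite in_setC => /notin_support qi.
  by rewrite exprS; apply: (primeMr _ (point_prime p)).
apply: (SR_depth2_glue covB sumX_in qb).
- by move=> G /BP[_ _ [v [_ [/setDP[vG vF] _ _]]]]; apply: restr_sumX_neq0 vG vF.
- move=> G f g /BP[_ _ [v [w [/setDP[vG vF] /setDP[wG wF] vw]]]].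
  rewrite restr_sumX (_ : restr G b = \sum_(i in G :&: ~: F) 'X_i ^+ i.+1).
    by apply: (sumX_power_reg (y := v) (z := w)) => //; rewrite in_setI in_setC ?vG ?wG.
  rewrite rmorph_sum /= (bigID (mem G)) /= addrC big1 ?add0r => [|i /andP[_ iG]].
    apply: eq_big => [i|i /andP[_ iG]]; first by rewrite in_setI andbC.
    by rewrite rmorphXn /= restrX iG.
  by rewrite rmorphXn /= restrX (negPf iG) expr0n.
move=> f h eh.
have common v G H : G \in B -> H \in B -> v \in G -> v \in H -> v \notin F ->
    restr (G :&: H) (h G) = restr (G :&: H) (h H).
  move=> GB HB vG vH vF.
  apply: (restr_quot_eq (subsetIl G H) (subsetIr G H) _ (eh G GB) (eh H HB)).
  by apply: restr_sumX_neq0 vF; rewrite inE vG.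
have commonF v G H : G \in B -> H \in B -> v \in G -> v \in H -> v \notin F ->
    restr F (h G) = restr F (h H).
  move=> GB HB vG vH vF; have [_ FG _] := BP G GB; have [_ FH _] := BP H HB.
  have FGH : F \subset G :&: H by rewrite subsetI FG.
  by rewrite -(restr_sub (h G) FGH) (common v) // restr_sub.
(* Consecutive edges of a path share a vertex outside [F], where the sum is nonzero, so the
   quotients keep the same restriction to [F]. *)
have along v w G H : connect (link_edge faces F) v w -> G \in B -> H \in B ->
    v \in G -> w \in H -> v \notin F -> restr F (h G) = restr F (h H).
  case/connectP=> s; elim: s v G => [|u s IHs] v G /=.
    by move=> _ -> GB HB vG vH vF; apply: (commonF v).
  case/andP=> vu pth lst GB HB vG wH vF; have EB := edgeB _ _ vu.
  transitivity (restr F (h (F :|: [set v; u]))).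
    by apply: (commonF v) => //; rewrite !in_setU !in_set1 eqxx orbT.
  apply: (IHs u) => //; first by rewrite !in_setU !in_set1 eqxx !orbT.
  by case/and4P: vu.
move=> G H GB HB; have [GD FG [v [_ [/setDP[vG vF] _ _]]]] := BP G GB.
have [HD FH [w [_ [/setDP[wH wF] _ _]]]] := BP H HB.
have [eF|[u /setDP[uGH uF]]] := set_0Vmem ((G :&: H) :\: F); last first.
  by case/setIP: uGH => uG uH; apply: (common u).
have -> : G :&: H = F.
  by apply/eqP; rewrite eqEsubset -setD_eq0 eF eqxx subsetI FG.
apply: (along v w) => //; apply: (conn _ _ _ _ _ e0) => //.
  by apply: faces_sub GD; rewrite subUset sub1set vG.
by apply: faces_sub HD; rewrite subUset sub1set wH.
Qed.

End Depth.

Lemma links_connected_serre2 (k : fieldType) (n : nat) (D : simplicial_complex 'I_n) :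
  links_connected D -> serre_condition 2 (SR_ring k D).
Proof.
move=> conn p [|[|[|//]]] _ dim; first exact: depth_geq0.
  exact: depth1.
have [fF|nfF] := pselect (facet D (vertex_support p)); first exact: depth2_facet.
have [zF|nzF] := pselect (zero_on p (vertex_support p)); first exact: depth2_origin.
exact: depth2_transversal.
Qed.

(** * Depth at least 2 implies connected links *)

Section KernelIdeal.
Variables (B : comNzRingType) (E : idomainType) (g : {rmorphism B -> E}).

Definition ker_ideal (x : B) : bool := g x == 0.

Lemma in_ker_ideal x : (x \in ker_ideal) = (g x == 0).
Proof. by []. Qed.

Lemma ker_ideal_closed : idealr_closed ker_ideal.
Proof.
split; rewrite ?in_ker_ideal ?rmorph0 ?rmorph1 ?oner_eq0 // => a x y.
by rewrite !in_ker_ideal rmorphD rmorphM => /eqP-> /eqP->; rewrite mulr0 addr0.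
Qed.

Lemma ker_ideal_prime : prime_idealr_closed ker_ideal.
Proof. by move=> x y; rewrite !in_ker_ideal rmorphM mulf_eq0. Qed.

HB.instance Definition _ := isIdealr.Build B ker_ideal ker_ideal_closed.
HB.instance Definition _ := isPrimeIdealrClosed.Build B ker_ideal ker_ideal_prime.

Definition ker_prime : prime_idealr B := ker_ideal.

Lemma mem_ker_prime x : (x \in ker_prime) = (g x == 0).
Proof. by []. Qed.

End KernelIdeal.

Section FacePrime.
Variables (k : fieldType) (n : nat) (D : simplicial_complex 'I_n).
Local Notation S := {mpoly k[n]}.
Local Notation R := (SR_ring k D).
Local Notation faces := (D : {set {set 'I_n}}).

Section Evaluation.
Variables (G : {set 'I_n}) (GD : G \in faces).

(** The quotient by the variables outside [G]. The membership proof is an argument because it makes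
    the value independent of the representative. *)
Definition face_eval of G \in faces := fun x : R => restr G (repr x : S).
Local Notation ev := (face_eval GD).

Lemma face_evalE f : ev (SR_of D f) = restr G f.
Proof.
apply/eqP; rewrite -subr_eq0 -rmorphB; apply/eqP.
have : SR_of D (repr (SR_of D f) - f) = 0.
  by rewrite rmorphB /= {1}/SR_of reprK subrr.
by move=> /SR_of_eq0/SR_idealP/(_ G GD).
Qed.

Lemma face_eval_zmod : zmod_morphism ev.
Proof.
move=> x y; have [f ->] := SR_of_surj x; have [g ->] := SR_of_surj y.
by rewrite -rmorphB !face_evalE rmorphB.
Qed.

Lemma face_eval_monoid : monoid_morphism ev.
Proof.
split=> [|x y]; first by rewrite -(rmorph1 (SR_of D)) face_evalE rmorph1.
have [f ->] := SR_of_surj x; have [g ->] := SR_of_surj y.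
by rewrite -rmorphM !face_evalE rmorphM.
Qed.

HB.instance Definition _ := GRing.isZmodMorphism.Build R S ev face_eval_zmod.
HB.instance Definition _ := GRing.isMonoidMorphism.Build R S ev face_eval_monoid.

End Evaluation.

Variables (F : {set 'I_n}) (FD : F \in faces).

Definition face_prime : prime_idealr R := ker_prime (face_eval FD).

Lemma mem_face_prime f : (SR_of D f \in face_prime) = (restr F f == 0).
Proof. by rewrite mem_ker_prime /= face_evalE. Qed.

Lemma face_prime_support : vertex_support face_prime = F.
Proof.
apply/setP => i; rewrite inE mem_face_prime restrX.
by case: ifP => _; rewrite ?eqxx ?X_neq0.
Qed.

Lemma face_eval_denom G (GD : G \in faces) : F \subset G ->
  forall s, s \notin face_prime -> face_eval GD s != 0.
Proof.
move=> FG s; have [f ->] := SR_of_surj s; rewrite mem_face_prime face_evalE.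
by apply: contraNneq => f0; rewrite -(restr_sub f FG) f0 rmorph0.
Qed.

(** The chain consists of the kernels of evaluation on [H], [v |: F] and [F]; ['X_w] and ['X_v] show
    that it is strict. *)
Lemma face_prime_dim2 v w :
  link_edge faces F v w -> krull_dim_geq (loc face_prime) 2.
Proof.
case/and4P=> vF wF vw HD; set H := F :|: _ in HD.
have GH : v |: F \subset H by rewrite subUset subsetUl sub1set !inE eqxx orbT.
have GD := faces_sub GH HD; have FG := subsetUr [set v] F.
pose K0 := loc_ker_idealr (face_eval_denom HD (subset_trans FG GH)).
pose K1 := loc_ker_idealr (face_eval_denom GD FG).
pose K2 := loc_ker_idealr (face_eval_denom FD (subxx F)).
have le G1 G2 (G1D : G1 \in faces) (G2D : G2 \in faces) : G1 \subset G2 ->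
    forall x, face_eval G2D x = 0 -> face_eval G1D x = 0.
  move=> s12 x; have [f ->] := SR_of_surj x; rewrite !face_evalE => f0.
  by rewrite -(restr_sub f s12) f0 rmorph0.
exists (fun i => if i is j.+1 then if j is _.+1 then K2 else K1 else K0).
case=> [|[|//]] _; split; try exact: loc_ker_le (le _ _ _ _ _).
- exists (loc_of face_prime (SR_of D 'X_w)); rewrite mem_loc_ker /= face_evalE restrX.
    by rewrite !inE [w == v]eq_sym (negPf vw) (negPf wF) eqxx.
  by rewrite !inE eqxx !orbT X_neq0.
- exists (loc_of face_prime (SR_of D 'X_v)); rewrite mem_loc_ker /= face_evalE restrX.
    by rewrite (negPf vF) eqxx.
  by rewrite !inE eqxx X_neq0.
Qed.

End FacePrime.

Lemma serre2_links_connected (k : fieldType) (n : nat) (D : simplicial_complex 'I_n) :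
  serre_condition 2 (SR_ring k D) -> links_connected D.
Proof.
move=> S2 F v0 w0 v w e0 vF vD wF wD; apply: contraT => nvw.
have FD : F \in (D : {set {set 'I_n}}) := faces_sub (subsetUr _ _) vD.
pose p := face_prime k FD; have eF : vertex_support p = F := face_prime_support k FD.
have [a [b [ap bp aI reg]]] := depth_geq2_elim
  (S2 p 2%N isT (face_prime_dim2 k FD e0)).
have [a' ea] := SR_of_surj a; have [b' eb] := SR_of_surj b; subst a b.
have star G : (G \in [set G in D : {set {set 'I_n}} | vertex_support p \subset G])
    = (G \in (D : {set {set 'I_n}})) && (F \subset G) by rewrite inE eF.
have locE f g := loc_SR_eq (covering_star p) f g.
(* [L] is the component of [v] in the link, so a face containing [F] cannot meet both [L] and the
   rest of the link. *)
pose L := [set u | connect (link_edge D F) v u & u \notin F].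
pose G1 := F :|: L; pose G2 := ~: L.
have vL : v \in L by rewrite inE connect0.
have wL : w \notin L by rewrite inE (negPf nvw).
have split_star G : G \in (D : {set {set 'I_n}}) -> F \subset G ->
    (G \subset G1) || (G \subset G2).
  move=> GD FG; apply: contraT; rewrite negb_or => /andP[/subsetPn[u' u'G]].
  rewrite in_setU negb_or => /andP[u'F u'L] /subsetPn[u uG].
  rewrite in_setC negbK => uL.
  have uu' : u != u' by apply: contraNneq u'L => <-.
  case/negP: u'L.
  have := uL; rewrite !inE u'F andbT => /andP[vu uF].
  apply: connect_trans vu (connect1 _); rewrite /link_edge uF u'F uu' /=.
  by apply: faces_sub GD; rewrite !subUset FG !sub1set uG.
have restrG1 (G : {set 'I_n}) (f : {mpoly k[n]}) :
    F \subset G -> G \subset G2 -> restr G (restr G1 f) = restr F f.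
  move=> FG GG2; rewrite restrI; congr (restr _ f); apply/eqP.
  rewrite eqEsubset; apply/andP; split; last by rewrite subsetI FG subsetUl.
  apply/subsetP => u; rewrite in_setI in_setU => /andP[/(subsetP GG2)].
  by rewrite in_setC => /negPf-> /[!orbF].
have a0 : restr F a' = 0 by apply/eqP; rewrite -(mem_face_prime FD).
have b0 : restr F b' = 0 by apply/eqP; rewrite -(mem_face_prime FD).
(* Inside [G1] the relation is commutativity; inside [G2] both restricted elements reduce to their
   restriction to [F], which is 0. *)
have [|z [s [sp]]] := reg (SR_of D (restr G1 a')) (SR_of D (restr G1 b')).
  rewrite -!rmorphM; apply/locE => G; rewrite star => /andP[GD FG].
  rewrite !rmorphM /=; case/orP: (split_star G GD FG) => GG.
    by rewrite !(restr_sub _ GG) mulrC.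
  by rewrite !restrG1 // a0 b0 !mulr0.
have [f ez] := SR_of_surj z; have [t es] := SR_of_surj s; subst z s.
rewrite -!rmorphM => /locE eta.
(* If [a'] vanished on all faces through [u], it would annihilate ['X_u], which is nonzero in the
   localization. *)
have wit u : u \notin F -> u |: F \in (D : {set {set 'I_n}}) ->
    exists G, [/\ G \in (D : {set {set 'I_n}}), F \subset G, u \in G & restr G a' != 0].
  move=> uF uD; apply: contrapT => nex.
  have /aI : loc_of p (SR_of D a') * loc_of p (SR_of D 'X_u) = 0.
    rewrite -!rmorphM; apply/(loc_SR_eq0 (covering_star p)) => G.
    rewrite star => /andP[GD FG]; rewrite rmorphM /= restrX.
    case: ifP => uG; last by rewrite mulr0.
    suff -> : restr G a' = 0 by rewrite mul0r.
    by apply/eqP; apply: contrapT => /negP anz; apply: nex; exists G.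
  move/(loc_SR_eq0 (covering_star p))/(_ (u |: F)); rewrite star uD subsetUr.
  by move/(_ isT)/eqP; rewrite restrX setU11 (negPf (X_neq0 _ _)).
have [G [GD FG vG aG]] := wit v vF vD; have [H [HD FH wH aH]] := wit w wF wD.
have GG1 : G \subset G1.
  case/orP: (split_star G GD FG) => // /subsetP/(_ v vG).
  by rewrite in_setC vL.
have HG2 : H \subset G2.
  case/orP: (split_star H HD FH) => // /subsetP/(_ w wH).
  by rewrite in_setU (negPf wF) (negPf wL).
(* On [G], a face in [G1], cancelling [a'] identifies [t] with [f]; on [H], a face in [G2], the left
   side is 0 and so [f] vanishes. Hence [t] is 0 on [F], and the denominator lies in [p]. *)
have etf : restr F t = restr F f.
  suff e : restr G t = restr G f by rewrite -(restr_sub t FG) e restr_sub.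
  apply: (mulIf aG); have := eta G; rewrite star GD FG !rmorphM /= => /(_ isT) <-.
  by rewrite (restr_sub _ GG1).
have f0 : restr F f = 0.
  rewrite -(restr_sub f FH); have := eta H; rewrite star HD FH !rmorphM /=.
  rewrite restrG1 // a0 mulr0 => /(_ isT)/esym/eqP.
  by rewrite mulf_eq0 (negPf aH) orbF => /eqP->; rewrite rmorph0.
by rewrite mem_face_prime etf f0 eqxx in sp.
Qed.

Local Open Scope nat_scope.

(** * Links in the independence complex of a circulant graph *)

Section Circulant.
Variables (n d : nat).
Hypotheses (hd : 2 <= 2 * d) (hn : 2 * d <= n).

Local Notation e := (circulant n [pred s : nat | 1 <= s <= d]).
Local Notation D := (independence_complex e : {set {set 'I_n}}).
Implicit Types (F : {set 'I_n}) (u v w : 'I_n).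

(** Cyclic distance greater than [d]; the sum of two truncated differences is the absolute
    difference, in a form suited to [lia]. *)
Definition far (i j : nat) : bool :=
  let m := (i - j) + (j - i) in (d < m) && (m + d < n).

Lemma circulantE u v : e u v = (u != v) && ~~ far u v.
Proof.
have -> : e u v = ((1 <= (u - v) + (v - u) <= d)
    || (1 <= n - ((u - v) + (v - u)) <= d)).
  rewrite /circulant (_ : absz _ = (u - v) + (v - u)); [by []|lia].
rewrite /far -val_eqE /=; have := ltn_ord u; have := ltn_ord v; lia.
Qed.

Lemma facesP F : reflect (forall u v, u \in F -> v \in F -> u != v -> far u v) (F \in D).
Proof.
rewrite inE; apply: (iffP forall_inP) => h u.
  move=> v uF vF uv; have /forall_inP/(_ v vF) := h u uF.
  by rewrite circulantE uv negbK.
move=> uF; apply/forall_inP => v vF; rewrite circulantE.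
by have [->|uv] := eqVneq u v; rewrite ?eqxx //= negbK h.
Qed.

Lemma far_sym i j : far i j = far j i.
Proof. by rewrite /far addnC. Qed.

Lemma face_setU1 F v : F \in D -> (forall u, u \in F -> far u v) -> v |: F \in D.
Proof.
move=> /facesP FD Fv; apply/facesP => u w.
rewrite !in_setU1 => /orP[/eqP->|uF] /orP[/eqP->|wF]; rewrite ?eqxx // => uw.
- by rewrite far_sym Fv.
- exact: Fv.
- exact: FD.
Qed.

Lemma far_notin F v : (forall u, u \in F -> far u v) -> v \notin F.
Proof. by move=> Fv; apply/negP => /Fv; rewrite /far; lia. Qed.

Lemma face_setU1_far F v u : v |: F \in D -> v \notin F -> u \in F -> far u v.
Proof.
move=> /facesP h vF uF; apply: h; rewrite ?setU11 ?in_setU1 ?uF ?orbT //.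
by apply: contraNneq vF => <-.
Qed.

Lemma link_edgeP F v w : F \in D -> reflect
  [/\ forall u, u \in F -> far u v, forall u, u \in F -> far u w & far v w]
  (link_edge D F v w).
Proof.
move=> FD; apply: (iffP and4P) => [[vF wF vw /facesP h]|[Fv Fw vw]].
  have inV : v \in F :|: [set v; w] by rewrite !inE eqxx orbT.
  have inW : w \in F :|: [set v; w] by rewrite !inE eqxx !orbT.
  split=> [u uF|u uF|]; last exact: h.
    by apply: h => //; [rewrite inE uF|apply: contraNneq vF => <-].
  by apply: h => //; [rewrite inE uF|apply: contraNneq wF => <-].
split; [exact: far_notin|exact: far_notin| |].
  by apply: contraTneq vw => ->; rewrite /far; lia.
rewrite setUA [_ :|: [set w]]setUC [F :|: _]setUC; apply: face_setU1; first exact: face_setU1.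
by move=> u; rewrite in_setU1 => /orP[/eqP->|/Fw].
Qed.

Lemma link_edge_sym F : F \in D -> connect_sym (link_edge D F).
Proof.
move=> FD; apply: sym_connect_sym => v w.
by apply/link_edgeP/link_edgeP => // -[Fv Fw vw]; split=> //; rewrite far_sym.
Qed.

Lemma set0_face : set0 \in D.
Proof. by apply/facesP => u v; rewrite inE. Qed.

Lemma connect_set0 v w : 2 * d + 3 <= n -> connect (link_edge D set0) v w.
Proof.
move=> n_big.
have edge u u' : far u u' -> link_edge D set0 u u'.
  by move=> fu; apply/link_edgeP; [exact: set0_face|split=> // ?; rewrite inE].
have up m u u' : u' = u + m :> nat -> connect (link_edge D set0) u u'.
  elim: m u' => [|m IHm] u' eu; first by rewrite (_ : u' = u) //;
    apply: val_inj; rewrite /= eu addn0.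
  have ltm : u + m < n by have := ltn_ord u'; lia.
  apply: connect_trans (IHm (Ordinal ltm) erefl) _.
  (* Consecutive vertices have a common neighbour, at distance [d + 2] from the first and [d + 1]
     from the second; [n_big] keeps the complementary arcs longer than [d]. *)
  have ltc : (if u + m + d + 2 < n then u + m + d + 2 else u + m + d + 2 - n) < n.
    by case: ifP; lia.
  apply: (@connect_trans _ _ (Ordinal ltc)); apply/connect1/edge; rewrite /far /=;
    have := ltn_ord u'; case: ifP; lia.
case: (leqP v w) => [vw|wv]; first by apply: (up (w - v)); lia.
by rewrite (link_edge_sym set0_face); apply: (up (v - w)); lia.
Qed.

Lemma connect_set1 (f v w : 'I_n) : n = 4 * d + 3 -> far f v -> far f w ->
  connect (link_edge D [set f]) v w.
Proof.
move=> en.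
have fD : [set f] \in D.
  by apply/facesP => u u'; rewrite !inE => /eqP-> /eqP->; rewrite eqxx.
have edge u u' : far f u -> far f u' -> far u u' -> link_edge D [set f] u u'.
  move=> fu fu' uu'; apply/link_edgeP => //.
  by split=> // x; rewrite inE => /eqP->.
(* [a] and [b] are the first and last of the [2 * d + 2] vertices far from [f]. They are far from
   each other, and each vertex in between is far from one of them. *)
have lta : (if f + d + 1 < n then f + d + 1 else f + d + 1 - n) < n.
  by have := ltn_ord f; case: ifP; lia.
have ltb : (if f + 3 * d + 2 < n then f + 3 * d + 2 else f + 3 * d + 2 - n) < n.
  by have := ltn_ord f; case: ifP; lia.
pose a := Ordinal lta; pose b := Ordinal ltb.
have fa : far f a by rewrite /far /=; have := ltn_ord f; case: ifP; lia.
have fb : far f b by rewrite /far /=; have := ltn_ord f; case: ifP; lia.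
have ab : far b a by rewrite /far /=; have := ltn_ord f; do 2 case: ifP; lia.
have toa u : far f u -> connect (link_edge D [set f]) u a.
  move=> fu; have [ua|ub] : far u a \/ far u b.
  - have := fu; rewrite /far /=; have := ltn_ord f; have := ltn_ord u.
    by do 2 case: ifP; lia.
  - exact/connect1/edge.
  - by apply: connect_trans (connect1 _) (connect1 _); apply: edge; [| |exact: ub| | |].
move=> /toa va /toa wa; apply: connect_trans va _.
by rewrite (link_edge_sym fD).
Qed.

(** Having [r] pairwise far vertices forces [r * (d + 1) <= n]. With [r = 2] the empty face needs
    [n >= 2 * d + 3]; [r = 3] leaves only [n = 4 * d + 3] for nonempty faces; [r = 4] then restricts
    these to single vertices. *)
Lemma circulant_links_connected :
  (n <= 3 * d + 2 /\ n <> 2 * d + 2) \/ n = 4 * d + 3 -> links_connected D.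
Proof.
move=> cond F v0 w0 v w e0 vF vD wF wD.
have FD : F \in D by apply: faces_sub vD; apply: subsetUr.
have [F0v F0w vw0] := link_edgeP v0 w0 FD e0.
have [eF|[f fF]] := set_0Vmem F.
  rewrite eF; apply: connect_set0; move: vw0; rewrite /far.
  have := ltn_ord v0; have := ltn_ord w0; lia.
have fv := F0v f fF; have fw := F0w f fF.
have en : n = 4 * d + 3.
  case: cond => // -[n_le _]; move: fv fw vw0; rewrite /far.
  have := ltn_ord v0; have := ltn_ord w0; have := ltn_ord f; lia.
have eF : F = [set f].
  apply/setP => g; rewrite inE; have [->//|gf] := eqVneq g f.
  apply/negP => gF; have /facesP/(_ g f gF fF gf) := FD.
  move: fv fw vw0 (F0v g gF) (F0w g gF); rewrite /far.
  have := ltn_ord v0; have := ltn_ord w0; have := ltn_ord f; have := ltn_ord g; lia.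
by rewrite eF; apply: connect_set1 => //; apply: face_setU1_far fF.
Qed.

(** Each vertex is far only from its antipode, at distance [d + 1], so the graph is a perfect
    matching: the pair of 0 and [d + 1] is closed and misses 1. *)
Lemma not_connected_matching : n = 2 * d + 2 -> ~ links_connected D.
Proof.
move=> en conn; have lt0 : 0 < n by lia.
have lt1 : 1 < n by lia.
have ltd : d.+1 < n by lia.
pose o := Ordinal lt0; pose u := Ordinal lt1; pose v := Ordinal ltd.
have e0 : link_edge D set0 o v.
  apply/link_edgeP; first exact: set0_face.
  by split=> [x|x|]; rewrite ?inE // /far /=; lia.
have vtx x : x |: set0 \in D.
  by apply: face_setU1; [exact: set0_face|move=> y; rewrite inE].
have out (x : 'I_n) : x \notin set0 by rewrite inE.
have := conn set0 o v o u e0 (out o) (vtx o) (out u) (vtx u).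
pose a := [pred x : 'I_n | (x == 0 :> nat) || (x == d.+1 :> nat)].
have cl : closed (link_edge D set0) a.
  move=> x y /(link_edgeP _ _ set0_face)[_ _]; rewrite /far !inE.
  have := ltn_ord x; have := ltn_ord y; lia.
by move=> /(closed_connect cl); rewrite !inE /=; lia.
Qed.

(* The cyclic gaps of this face are all at most [2 * d], so they leave no room
   for a further vertex, except the one that goes from [l] back to 0. *)
Definition comb (l : nat) : {set 'I_n} :=
  [set i : 'I_n | (i == l :> nat) || (d.+1 %| i) && (i + d.+1 <= l)].

Lemma comb_face l : l + 3 * d + 3 <= n -> comb l \in D.
Proof.
move=> ln; apply/facesP => u v uC vC uv.
wlog ltuv : u v uC vC uv / u < v.
  move=> h; have := uv; rewrite -val_eqE neq_ltn => /orP[/h|lt]; first exact.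
  by rewrite far_sym h // eq_sym.
have le_v : v <= l by move: vC; rewrite inE; lia.
suff : d.+1 <= v - u by rewrite /far; lia.
move: uC vC; rewrite !inE => /orP[/eqP eu|/andP[du ul]] /orP[/eqP ev|/andP[dv vl]];
  try lia.
by apply: dvdn_leq; rewrite ?subn_gt0 ?dvdn_sub.
Qed.

Lemma comb_far l x : (l == 0) || (d < l) ->
  (l + d < x) && (x + d < n) -> forall u, u \in comb l -> far u x.
Proof. by move=> l0 lx u; rewrite inE /far; lia. Qed.

Lemma comb_gap l x : (l == 0) || (d < l) -> l + 3 * d + 3 <= n -> x < n ->
  (forall u, u \in comb l -> far u x) -> (l + d < x) && (x + d < n).
Proof.
move=> l0 ln xn h.
have ltl : l < n by lia.
have lt0 : 0 < n by lia.
have /h : Ordinal ltl \in comb l by rewrite inE /= eqxx.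
(* By [l0] the comb contains 0; for [0 < l <= d] it would consist of [l] alone. *)
have /h : Ordinal lt0 \in comb l by rewrite inE /=; lia.
rewrite /far /=; have [xl|] := ltnP x l; last by lia.
(* The multiple of [d.+1] just below [x] is within [d] of [x]; either it is a tooth of the comb, or
   [l] itself is too close to [x]. *)
have qx := leq_trunc_div x d.+1; have rx := ltn_ceil x (ltn0Sn d).
have ltq : x %/ d.+1 * d.+1 < n by lia.
have [ql|ql] := leqP (x %/ d.+1 * d.+1 + d.+1) l; last by rewrite mulSn in rx; lia.
have /h : Ordinal ltq \in comb l by rewrite inE /= dvdn_mull //= ql orbT.
by rewrite /far /= => + _; rewrite mulSn in rx; lia.
Qed.

Lemma not_connected_gap l : (l == 0) || (d < l) ->
  l + 3 * d + 3 <= n -> n <= l + 4 * d + 2 -> ~ links_connected D.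
Proof.
move=> l0 ln nl conn; have CD := comb_face ln.
(* The ends of the gap are [l + d + 1] and [n - d - 1], which are far from each other;
   [l + 2 * d + 1] is within [d] of both, hence isolated in the link. *)
have lta : l + d + 1 < n by lia.
have ltb : n - d - 1 < n by lia.
have ltz : l + 2 * d + 1 < n by lia.
have Ca : forall u, u \in comb l -> far u (Ordinal lta) by apply: comb_far => //=; lia.
have Cb : forall u, u \in comb l -> far u (Ordinal ltb) by apply: comb_far => //=; lia.
have Cz : forall u, u \in comb l -> far u (Ordinal ltz) by apply: comb_far => //=; lia.
have e0 : link_edge D (comb l) (Ordinal lta) (Ordinal ltb).
  by apply/link_edgeP => //; split=> //; rewrite /far /=; lia.
have /connectP[[|x s] /=] := conn _ _ _ _ _ e0 (far_notin Cz) (face_setU1 CD Cz)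
    (far_notin Ca) (face_setU1 CD Ca).
  by move=> _ /(congr1 val) /=; lia.
case/andP=> /(link_edgeP _ _ CD)[_ Cx] + _ _.
have := comb_gap l0 ln (ltn_ord x) Cx.
by rewrite /far /=; lia.
Qed.

Lemma links_connected_circulant :
  links_connected D -> (n <= 3 * d + 2 /\ n <> 2 * d + 2) \/ n = 4 * d + 3.
Proof.
move=> conn; have [n_le|n_gt] := leqP n (3 * d + 2).
  by left; split=> // /not_connected_matching.
right; have [n_le|] := leqP n (4 * d + 2).
  by case: (@not_connected_gap 0) => //; lia.
rewrite leq_eqVlt => /orP[/eqP|n_lt]; first by lia.
(* This is the largest [l] allowed and leaves a gap of exactly [d + 2] vertices; [n >= 4 * d + 4]
   gives [d < l]. *)
by case: (@not_connected_gap (n - (3 * d + 3))) => //; lia.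
Qed.

End Circulant.

Theorem theorem2p2 (k : fieldType) (n d : nat) (hd : 2 <= 2 * d) (hn : 2 * d <= n) :
  is_S2 k (circulant n [pred s : nat | 1 <= s <= d])
  <-> (n <= 3 * d + 2 /\ n <> 2 * d + 2) \/ n = 4 * d + 3.
Proof.
split=> [/serre2_links_connected|cond]; first exact: links_connected_circulant.
exact/links_connected_serre2/circulant_links_connected.
Qed.
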